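(* Let $c,\lambda,\alpha>0$ and let $X_t = c t - \sum_{i=1}^{N_t} C_i$, $t\ge 0$, where $N=\{N_t,t\ge 0\}$ is a Poisson process with rate $\lambda$ and $(C_i)_{i\ge 1}$ is a sequence of i.i.d. exponential random variables with rate $\alpha$, independent of $N$ (so $X_0=0$). Then, for every fixed $t>0$, the law of the occupation time of the negative half-line is $$\mathbb{P}\left(\int_0^t \mathbf{1}_{(-\infty,0)}(X_u)\,\mathrm{d}u\in \mathrm{d}s\right) = a_t\,\delta_0(\mathrm{d}s) + a_{t-s}\bigl(\lambda - c\alpha(1-a_s)\bigr)\mathbf{1}_{(0,t)}(s)\,\mathrm{d}s ,$$ where, with $z_+:=\max(z,0)$, $$a_t = \left(1-\frac{\lambda}{c\alpha}\right)_+ + \frac{2\lambda}{\pi}\,e^{-(\lambda+c\alpha)t}\int_{-1}^{1}\frac{\sqrt{1-u^2}}{\lambda+c\alpha+2\sqrt{c\alpha\lambda}\,u}\,e^{-2\sqrt{c\alpha\lambda}\,t\,u}\,\mathrm{d}u .$$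
   Context: $\delta_0$ denotes the Dirac mass at $0$. $X$ is the surplus process in the Cramér–Lundberg model with exponential claims, with premium rate $c$, claim arrival rate $\lambda$ and exponential claim parameter $\alpha$ (mean claim size $1/\alpha$). *)

(* Defs.v *)
From HB Require Import structures.
From mathcomp Require Import all_boot all_order all_algebra.
From mathcomp Require Import all_classical all_reals all_analysis.

Set Implicit Arguments.
Unset Strict Implicit.
Unset Printing Implicit Defensive.

Import Order.TTheory GRing.Theory Num.Theory.
Import numFieldNormedType.Exports.

Local Open Scope classical_set_scope.
Local Open Scope ring_scope.

Section independence.
Context {d : measure_display} {T : measurableType d} {R : realType}.
Variable P : probability T R.

Definition mutually_independent {d' : measure_display} {T' : measurableType d'}
    {I : eqType} (X : I -> T -> T') : Prop :=
  forall (J : seq I) (B : I -> set T'), uniq J ->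
    (forall i, measurable (B i)) ->
    P (\bigcap_(i in [set` J]) X i @^-1` B i) =
      (\prod_(i <- J) P (X i @^-1` B i))%E.

Definition independent_systems (F G : set (set T)) : Prop :=
  forall A B, F A -> G B -> P (A `&` B) = (P A * P B)%E.

End independence.

Definition sigma_process {d d' : measure_display} {T : measurableType d}
    {T' : measurableType d'} {I : Type} (D : set I) (X : I -> T -> T') :
    set (set T) :=
  <<s \bigcup_(i in D) preimage_set_system setT (X i) measurable >>.

Section cramer_lundberg.
Context {d : measure_display} {T : measurableType d} {R : realType}.
Variable P : probability T R.

(* The time index ranges over all of R, but only the values at nonnegative
   times are constrained.  In [pp_indep] a finite partition is covered by
   prolonging it into an eventually constant sequence. *)
Record poisson_process (lambda : R) (N : R -> {RV P >-> nat}) : Prop := {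
  pp_start : forall w, N 0 w = 0%N ;
  pp_nondecreasing : forall w (s t : R), 0 <= s -> s <= t -> (N s w <= N t w)%N ;
  (* right-continuity, for integer-valued paths *)
  pp_right_continuous : forall w (t : R), 0 <= t ->
    \forall u \near t^'+, N u w = N t w ;
  pp_indep : forall tau : nat -> R, 0 <= tau 0%N ->
    (forall i, tau i <= tau i.+1) ->
    mutually_independent P
      (fun i w => (N (tau i.+1) w - N (tau i) w)%N) ;
  pp_increments : forall (s t : R) (k : nat), 0 <= s -> s < t ->
    P [set w | (N t w - N s w)%N = k] =
      (poisson_pmf (lambda * (t - s)) k)%:E
}.

Record iid_exponential (alpha : R) (C : nat -> {RV P >-> R}) : Prop := {
  iid_indep : mutually_independent P (fun i => C i : T -> R) ;
  iid_law : forall i (B : set R), measurable B ->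
    distribution P (C i) B = exponential_prob alpha B
}.

(* The claims are numbered from 0: [C i] is the (i+1)-st claim. *)
Definition surplus (c : R) (N : R -> {RV P >-> nat}) (C : nat -> {RV P >-> R})
    (t : R) (w : T) : R :=
  c * t - \sum_(i < N t w) C i w.

Definition occupation_time (X : R -> T -> R) (t : R) (w : T) : R :=
  \int[lebesgue_measure]_(u in `[0, t]) \1_(`]-oo, 0[ : set R) (X u w).

End cramer_lundberg.

(* At u = -1 the integrand is the junk value 0 when lambda = c * alpha, on a
   Lebesgue-null set. *)
Definition a_ {R : realType} (c lambda alpha t : R) : R :=
  Num.max (1 - lambda / (c * alpha)) 0 +
  2 * lambda / pi * expR (- (lambda + c * alpha) * t) *
  \int[lebesgue_measure]_(u in `[-1, 1])
    (Num.sqrt (1 - u ^+ 2)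
       / (lambda + c * alpha + 2 * Num.sqrt (c * alpha * lambda) * u)
     * expR (- 2 * Num.sqrt (c * alpha * lambda) * t * u)).

(* Main.v *)
Require Import Defs.
From HB Require Import structures.
From mathcomp Require Import all_boot all_order all_algebra.
From mathcomp Require Import all_classical all_reals all_analysis.
From mathcomp Require Import measurable_realfun ring lra zify.
Import Order.TTheory GRing.Theory Num.Theory.
Import numFieldNormedType.Exports.
Set Implicit Arguments.
Unset Strict Implicit.
Unset Printing Implicit Defensive.
Local Open Scope classical_set_scope.
Local Open Scope ring_scope.

(** The proof replaces the surplus by a lazy nearest-neighbour walk on a grid,
    uses the Sparre Andersen identity for that walk, and lets the mesh tend
    to 0.

    Cut [0, t] into n + 1 steps of length delta and round every claim up to a
    multiple of c * delta, the income of one step.  At the grid times the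
    surplus is negative exactly when more claims have arrived than claims whose
    total the income has covered.  Rounded exponential claims are geometric, so
    in each step a claim total is completed with probability
    1 - exp(- c alpha delta), independently; arrivals are Poisson.  Hence,
    outside an event of probability o(1), the sign of the surplus is the sign
    of a walk that goes up at rate c alpha, down at rate lambda, and otherwise
    stays ([prob_word], [lattice_count_expectation]).  Along every path with
    nonnegative claims, delta times the number of negative grid values tends to
    the occupation time ([lattice_occupation_cvg]).

    For a walk with independent identically distributed steps, the number of
    negative partial sums among n has the law of the first time at which the
    minimum is reached, that is p_k * q_(n-k), where p_k and q_k are the
    probabilities that the first k partial sums are all negative and all
    nonnegative ([sparre_andersen]).  For nearest-neighbour steps (up u, stay z,
    down d), expanding in Chebyshev polynomials gives
    q_k = 1 - (2 / pi) d int_(-1)^1 sqrt(1 - x^2) sum_(j<k) (z - 2 sqrt(ud) x)^j dx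
    ([surv_semicircle]), and p_(k+1) is d times the same quantity with u and d
    exchanged.  The integral depends on u and d only through u * d, so the two
    are linked by p_(k+1) = d - u (1 - q_k); this is where the factor
    lambda - c alpha (1 - a_s) comes from.

    In the limit q_k tends to
    1 - (2 lambda / pi) int sqrt(1 - x^2) (1 - exp(- s kappa)) / kappa dx with
    kappa = lambda + c alpha + 2 sqrt(c alpha lambda) x ([surv_cvg]).  This is
    a_s, since int sqrt(1 - x^2) / kappa dx = pi / (2 max(lambda, c alpha)), the
    integral of a Poisson kernel ([kappa_inv_integral], [a_E]).  The sums
    sum_k f(k delta) p_k q_(n-k) are Riemann sums, so the expectation of f at the
    occupation time is the integral of f against the announced law for every
    continuous f with values in [0, 1] ([occupation_test]); such f approximate
    the indicators of the half-lines, which determine a law. *)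

(** * The Sparre Andersen identity for weighted words *)

Section word_sums.
Context {R : comPzRingType}.
Variables (steps : seq int) (w : int -> R).

(** The expectation of [F] over words of [n] independent letters with weights
    [w], which need not sum to 1; peeling off the first letter makes it a
    recursion. *)
Fixpoint wsum (n : nat) (F : seq int -> R) : R :=
  if n is m.+1 then \sum_(e <- steps) w e * wsum m (fun s => F (e :: s))
  else F [::].

Lemma wsumS n F :
  wsum n.+1 F = \sum_(e <- steps) w e * wsum n (fun s => F (e :: s)).
Proof. by []. Qed.

Lemma eq_wsum n F G : (forall s, size s = n -> F s = G s) ->
  wsum n F = wsum n G.
Proof.
elim: n F G => [|n IH] F G FG /=; first exact: FG.
by apply: eq_bigr => e _; congr (_ * _); apply: IH => s hs; rewrite FG //= hs.
Qed.

Lemma wsumD n F G : wsum n (fun s => F s + G s) = wsum n F + wsum n G.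
Proof.
elim: n F G => [//|n IH] F G /=.
by rewrite -big_split /=; apply: eq_bigr => e _; rewrite IH mulrDr.
Qed.

Lemma wsumZ n a F : wsum n (fun s => a * F s) = a * wsum n F.
Proof.
elim: n F => [//|n IH] F /=.
by rewrite big_distrr /=; apply: eq_bigr => e _; rewrite IH mulrCA.
Qed.

Lemma wsum_sum n (I : Type) (r : seq I) F :
  wsum n (fun s => \sum_(i <- r) F i s) = \sum_(i <- r) wsum n (F i).
Proof.
elim: r => [|i r IH].
  rewrite big_nil -[RHS](mul0r (wsum n (fun=> 0))) -wsumZ.
  by apply: eq_wsum => s _; rewrite big_nil mul0r.
rewrite big_cons -IH -wsumD; apply: eq_wsum => s _; exact: big_cons.
Qed.

(** Together with the defining recursion, this lets a letter be removed at
    either end, which is all that the exchangeability argument needs. *)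
Lemma wsum_rcons n F :
  wsum n.+1 F = \sum_(e <- steps) w e * wsum n (fun s => F (rcons s e)).
Proof.
elim: n F => [|n IH] F; first by [].
transitivity (\sum_(e <- steps) \sum_(e' <- steps)
    w e * (w e' * wsum n (fun s => F (e :: rcons s e')))).
  rewrite [LHS]/=; apply: eq_bigr => e _; rewrite -big_distrr /=.
  by congr (_ * _); exact: (IH (fun s => F (e :: s))).
rewrite exchange_big /=; apply: eq_bigr => e _.
by rewrite big_distrr /=; apply: eq_bigr => e' _; rewrite mulrCA.
Qed.

Lemma wsum_rev n F : wsum n (fun s => F (rev s)) = wsum n F.
Proof.
elim: n F => [//|n IH] F; rewrite wsum_rcons /=.
apply: eq_bigr => e _; rewrite -[in RHS]IH.
by congr (_ * _); apply: eq_wsum => s _; rewrite rev_rcons.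
Qed.

Lemma wsum_cat m n F :
  wsum (m + n) F = wsum m (fun s => wsum n (fun s' => F (s ++ s'))).
Proof.
elim: m F => [//|m IH] F /=; apply: eq_bigr => e _; by rewrite IH.
Qed.

Lemma wsum1 n : wsum n (fun=> 1) = (\sum_(e <- steps) w e) ^+ n.
Proof.
elim: n => [|n IH] /=; first by rewrite expr0.
by rewrite IH -big_distrl exprS.
Qed.

Definition sumz (s : seq int) : int := \sum_(e <- s) e.

Lemma sumz_cons e s : sumz (e :: s) = e + sumz s.
Proof. exact: big_cons. Qed.

Lemma sumz_rcons e s : sumz (rcons s e) = sumz s + e.
Proof. by rewrite /sumz -cats1 big_cat big_seq1. Qed.

(** The partial sums start at [x], which is itself not counted. *)
Fixpoint negs (x : int) (s : seq int) : nat :=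
  if s is e :: s' then ((x + e < 0)%R + negs (x + e) s')%N else 0.

Lemma negs_rcons x s e : negs x (rcons s e) = (negs x s + (x + sumz s + e < 0)%R)%N.
Proof.
elim: s x => [|e' s IH] x /=; first by rewrite /sumz big_nil addr0 addn0 add0n.
by rewrite IH sumz_cons addrA addnA.
Qed.

Lemma negs_size x s : (negs x s <= size s)%N.
Proof. by elim: s x => [//|e s IH] x /=; rewrite -add1n leq_add ?leq_b1. Qed.

(** The empty prefix takes part in the minimum. *)
Fixpoint minsum (s : seq int) : int :=
  if s is e :: s' then Num.min 0 (e + minsum s') else 0.

(** The first time at which the partial sums reach their minimum. *)
Fixpoint argminsum (s : seq int) : nat :=
  if s is e :: s' then
    if e + minsum s' < 0 then (argminsum s').+1 else 0%N
  else 0%N.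

Lemma minsum_le0 s : minsum s <= 0.
Proof. by case: s => //= e s; rewrite ge_min lexx. Qed.

Lemma minsum_le_sumz s : minsum s <= sumz s.
Proof.
elim: s => [|e s IH] /=; first by rewrite /sumz big_nil.
by rewrite sumz_cons ge_min lerD2l IH orbT.
Qed.

Lemma minsum_rcons s e : minsum (rcons s e) = Num.min (minsum s) (sumz s + e).
Proof.
elim: s => [|e' s IH] /=; first by rewrite /sumz big_nil addr0 add0r.
by rewrite IH sumz_cons -addrA addr_minr minA.
Qed.



Lemma argminsum_rcons s e :
  minsum s <= sumz s + e -> argminsum (rcons s e) = argminsum s.
Proof.
elim: s => [|e' s IH] /=.
  by rewrite /sumz big_nil add0r addr0 => e0; rewrite ltNge e0.
rewrite sumz_cons minsum_rcons addr_minr gt_min addrA => h.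
case: (ltP (e' + minsum s) 0) => h1 /=.
  by rewrite IH //; move: h; rewrite ge_min; lia.
by move: h; rewrite ge_min ltNge; case: leP => //; lia.
Qed.

Lemma argminsum_cat_size s1 s2 : argminsum (s1 ++ s2) = size s1 ->
  minsum (s1 ++ s2) = sumz s1.
Proof.
elim: s1 => [|e s1 IH] /=.
  rewrite /sumz big_nil; case: s2 => //= e s2; case: ltP => // h _; lia.
by case: ltP => // h [/IH H]; rewrite sumz_cons -H; lia.
Qed.

Fixpoint allneg (x : int) (s : seq int) : bool :=
  if s is e :: s' then (x + e < 0) && allneg (x + e) s' else true.
Fixpoint allnneg (x : int) (s : seq int) : bool :=
  if s is e :: s' then (0 <= x + e) && allnneg (x + e) s' else true.

Lemma allneg_rcons x s e :
  allneg x (rcons s e) = allneg x s && (x + sumz s + e < 0).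
Proof.
elim: s x => [|e' s IH] x /=; first by rewrite /sumz big_nil addr0 andbT.
by rewrite IH sumz_cons addrA andbA.
Qed.

Lemma allnnegE x s : 0 <= x -> allnneg x s = (0 <= x + minsum s).
Proof.
elim: s x => [|e s IH] x x0 /=; first by rewrite addr0 x0.
rewrite addr_minr addr0 le_min x0 addrA /=.
case: (leP 0 (x + e)) => h /=; first by rewrite IH.
by apply/esym/negbTE; rewrite -ltNge; have := minsum_le0 s; lia.
Qed.

Lemma argminsum_eq0 s : (argminsum s == 0%N) = allnneg 0 s.
Proof.
rewrite allnnegE // add0r; case: s => //= e s.
by rewrite le_min lexx /= leNgt; case: ltP.
Qed.

Lemma sumz_rev s : sumz (rev s) = sumz s.
Proof. by apply: perm_big; rewrite perm_rev. Qed.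

(** The minimum is first reached at the end of [s1] when, read backwards, [s1]
    has only negative partial sums and, after it, no partial sum goes below. *)
Lemma argminsum_cat s1 s2 : (argminsum (s1 ++ s2) == size s1) =
  allneg 0 (rev s1) && allnneg 0 s2.
Proof.
elim: s1 => [|e s1 IH]; first by rewrite /= argminsum_eq0.
rewrite rev_cons allneg_rcons sumz_rev add0r /= -andbAC -IH.
case: ifPn => h.
  rewrite eqSS; case: eqP => //= H; rewrite -(argminsum_cat_size H); lia.
rewrite eq_sym /=; apply/esym/negbTE; apply/negP => /andP[/eqP H].
by rewrite -(argminsum_cat_size H) addrC (negbTE h).
Qed.

(** By induction on the length, with a symmetric weight [Phi] so that the
    hypothesis can be used after the last letter is fixed.  If the total is
    nonnegative, dropping the last letter changes neither statistic.  If it is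
    negative, dropping the last letter lowers [negs] by one, while dropping the
    first letter lowers [argminsum] by one; the two deletions are exchanged by
    symmetry. *)
Lemma sparre_andersen_sym n (Phi : seq int -> R) (k : nat) :
  (forall s s', perm_eq s s' -> Phi s = Phi s') ->
  wsum n (fun s => Phi s * (negs 0 s == k)%:R) =
  wsum n (fun s => Phi s * (argminsum s == k)%:R).
Proof.
elim: n Phi k => [//|n IH] Phi k sym.
have pm s e : Phi (rcons s e) = Phi (e :: s) by apply: sym; rewrite perm_rcons.
(* The sign of the total is itself symmetric in the remaining letters. *)
pose lo e s := Phi (rcons s e) * (sumz s + e < 0)%R%:R.
pose hi e s := Phi (rcons s e) * (0 <= sumz s + e)%R%:R.
have losym e s s' : perm_eq s s' -> lo e s = lo e s'.
  move=> ss'; rewrite /lo /sumz (perm_big _ ss') /=; congr (_ * _).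
  by apply: sym; rewrite -!cats1 perm_cat2r.
have hisym e s s' : perm_eq s s' -> hi e s = hi e s'.
  move=> ss'; rewrite /hi /sumz (perm_big _ ss') /=; congr (_ * _).
  by apply: sym; rewrite -!cats1 perm_cat2r.
pose T e := wsum n (fun s => hi e s * (argminsum s == k)%:R) +
  wsum n (fun s => lo e s * (if k is k'.+1 then (argminsum s == k')%:R else 0)).
transitivity (\sum_(e <- steps) w e * T e).
  rewrite wsum_rcons; apply: eq_bigr => e _; congr (_ * _).
  rewrite /T -IH; last exact: hisym.
  have -> : wsum n (fun s => lo e s * (if k is k'.+1 then (argminsum s == k')%:R else 0)) =
     wsum n (fun s => lo e s * (if k is k'.+1 then (negs 0 s == k')%:R else 0)).
    by case: (k) => [|k0]; [apply: eq_wsum => s _; rewrite !mulr0|rewrite IH //; exact: losym].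
  rewrite -wsumD; apply: eq_wsum => s _; rewrite negs_rcons add0r /lo /hi leNgt.
  case: ltP => _; rewrite !(mulr1, mulr0, mul0r, addr0, add0r, addn0) //.
  by rewrite addn1; case: (k) => [|k0]; rewrite ?mulr0.
pose lo' s := Phi s * (sumz s < 0)%R%:R * (argminsum s == k)%:R.
pose hi' s := Phi s * (0 <= sumz s)%R%:R * (argminsum s == k)%:R.
transitivity (wsum n.+1 hi' + wsum n.+1 lo'); last first.
  rewrite -wsumD; apply: eq_wsum => s _; rewrite /lo' /hi' leNgt.
  by case: ltP => _; rewrite !(mulr1, mulr0, mul0r, addr0, add0r).
rewrite wsum_rcons /= -big_split /=; apply: eq_bigr => e _.
rewrite -mulrDr; congr (_ * (_ + _)); apply: eq_wsum => s _.
  rewrite /hi /hi' sumz_rcons; case: leP => h; rewrite ?(mulr0,mul0r) //.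
  by rewrite argminsum_rcons //; have := minsum_le0 s; lia.
rewrite /lo /lo' sumz_cons [e + _]addrC pm; case: ltP => h; rewrite ?(mulr0,mul0r) //=.
have -> : e + minsum s < 0 by have := minsum_le_sumz s; lia.
by case: (k) => [|k0]; rewrite ?mulr0.
Qed.

(** The law of [argminsum] factors because the letters before and after the
    first minimum are independent, and reversing a word preserves its weight. *)
Theorem sparre_andersen n k : (k <= n)%N ->
  wsum n (fun s => (negs 0 s == k)%:R) =
  wsum k (fun s => (allneg 0 s)%:R) * wsum (n - k) (fun s => (allnneg 0 s)%:R).
Proof.
move=> kn; transitivity (wsum n (fun s => (argminsum s == k)%:R)).
  have := @sparre_andersen_sym n (fun=> 1) k (fun _ _ _ => erefl).
  have e1 F : wsum n (fun s => 1 * F s) = wsum n F.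
    by apply: eq_wsum => s _; rewrite mul1r.
  by rewrite !e1.
rewrite -[in LHS](subnKC kn) wsum_cat -[wsum k _]wsum_rev [RHS]mulrC -wsumZ.
apply: eq_wsum => s hs; rewrite mulrC -wsumZ; apply: eq_wsum => s' _.
by rewrite -natrM mulnb -hs -(size_rev s) argminsum_cat revK.
Qed.

End word_sums.

Section lazy_walk.
Context {R : comPzRingType}.

Definition lazy_steps : seq int := [:: 1; 0; -1].

Definition lazy_weight (u z d : R) (e : int) : R :=
  if e == 1 then u else if e == 0 then z else d.

Local Notation lsum u z d := (wsum lazy_steps (lazy_weight u z d)).

(** The probability that the walk with step probabilities [u] (up), [z] (stay)
    and [d] (down), started at height [i], is nonnegative at its first [n]
    steps. *)
Fixpoint surv (u z d : R) (n i : nat) : R :=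
  if n is m.+1 then
    u * surv u z d m i.+1 + z * surv u z d m i +
    (if i is j.+1 then d * surv u z d m j else 0)
  else 1.

Lemma lsumS u z d n F : lsum u z d n.+1 F =
  u * lsum u z d n (fun s => F (1 :: s)) +
  z * lsum u z d n (fun s => F (0 :: s)) +
  d * lsum u z d n (fun s => F (-1 :: s)).
Proof. by rewrite /= /lazy_steps !big_cons big_nil addr0 addrA. Qed.

Lemma lsum0 u z d n : lsum u z d n (fun=> 0) = 0.
Proof.
have /= := wsumZ lazy_steps (lazy_weight u z d) n 0 (fun=> 0).
by rewrite !mul0r.
Qed.

Lemma lsum_nneg u z d n (i : nat) :
  lsum u z d n (fun s => (allnneg i%:Z s)%:R) = surv u z d n i.
Proof.
elim: n i => [//|n IH] i; rewrite lsumS /= !addr0.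
have -> : i%:Z + 1 = i.+1%:Z by lia.
congr (_ * _ + _ * _ + _).
- by rewrite -IH.
- by rewrite -IH.
case: i => [|i].
  by rewrite add0r lsum0 mulr0.
by rewrite -IH; congr (_ * _); apply: eq_wsum => s _; rewrite (_ : i.+1%:Z + -1 = i); last lia.
Qed.

(** Reflection turns staying below into staying above, with [u] and [d]
    exchanged. *)
Lemma lsum_neg u z d n (i : nat) :
  lsum u z d n (fun s => (allneg (- i.+1%:Z) s)%:R) = surv d z u n i.
Proof.
elim: n i => [//|n IH] i; rewrite lsumS /=.
rewrite [LHS]addrC [LHS]addrA [LHS]addrAC.
congr (_ * _ + _ * _ + _).
- rewrite -IH; apply: eq_wsum => s _.
  by rewrite (_ : - i.+1%:Z + -1 = - i.+2%:Z); last lia.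
- by rewrite -IH; apply: eq_wsum => s _; rewrite addr0.
case: i => [|i]; first by rewrite addNr lsum0 mulr0.
rewrite -IH; congr (_ * _); apply: eq_wsum => s _.
by rewrite (_ : - i.+2%:Z + 1 = - i.+1%:Z); last lia.
Qed.

Lemma lsum_negs u z d n k : (k <= n)%N ->
  lsum u z d n (fun s => (negs 0 s == k)%:R) =
  (if k is j.+1 then d * surv d z u j 0 else 1) * surv u z d (n - k) 0.
Proof.
move=> kn; rewrite sparre_andersen // (lsum_nneg _ _ _ _ 0); congr (_ * _).
case: k {kn} => [//|k]; rewrite lsumS /= !lsum0 !mulr0 !add0r.
by rewrite -lsum_neg; congr (_ * _); apply: eq_wsum => s _; rewrite add0r.
Qed.

End lazy_walk.

Arguments wsum : simpl never.

(** * Spectral formula for the lazy walk *)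

Section semicircle.
Context {R : realType}.
Local Notation mu := (@lebesgue_measure R).

Lemma continuous_itv_integrable (f : R -> R) (a b : R) :
  continuous f -> mu.-integrable `[a, b] (EFin \o f).
Proof.
move=> cf; apply: continuous_compact_integrable; first exact: segment_compact.
exact: continuous_subspaceT.
Qed.

Lemma cos_natmul_integral (k : nat) :
  \int[mu]_(x in `[0, pi]) cos (k%:R * x) = if k == 0%N then pi else 0.
Proof.
have pi0 : (0 : R) < pi by exact: pi_gt0.
case: eqP => [->|/eqP k0].
  under eq_Rintegral do rewrite mul0r cos0.
  rewrite Rintegral_cst // mul1r.
  suff E : mu `[0, pi] = pi%:E by exact: (congr1 fine E).
  by rewrite lebesgue_measure_itv /= lte_fin pi0 sube0.
have kn0 : (k%:R : R) != 0 by rewrite pnatr_eq0.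
pose F (x : R) := k%:R^-1 * sin (k%:R * x).
have dF (x : R) : is_derive x 1 F (cos (k%:R * x)).
  rewrite /F; apply: is_derive_eq.
  rewrite /GRing.scale /= mulr1; by field.
have cc (c : R) : continuous (fun x : R => c * x).
  by move=> x; apply: cvgM; [exact: cvg_cst|exact: cvg_id].
have cF : continuous F.
  move=> x; apply: differentiable_continuous; apply/derivable1_diffP.
  exact: (@ex_derive _ _ _ _ _ _ _ (dF x)).
rewrite /Rintegral (@continuous_FTC2 _ _ F) //.
- have sinpin (n : nat) : sin (n%:R * pi) = 0 :> R.
    elim: n => [|n IH]; first by rewrite mul0r sin0.
    by rewrite -natr1 mulrDl mul1r sinDpi IH oppr0.
  by rewrite /= /F sinpin !mulr0 sin0 mulr0 subr0.
- apply: continuous_subspaceT => x; apply: continuous_comp; first exact: cc.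
  exact: continuous_cos.
- split.
  + by move=> x _; exact: (@ex_derive _ _ _ _ _ _ _ (dF x)).
  + by apply: cvg_at_right_filter; exact: cF.
  + by apply: cvg_at_left_filter; exact: cF.
- by move=> x _; rewrite derive1E; exact: (@derive_val _ _ _ _ _ _ _ (dF x)).
Qed.

Definition semicircle (p : {poly R}) : R :=
  \int[mu]_(x in `[-1, 1]) (Num.sqrt (1 - x ^+ 2) * p.[x]).

Lemma continuous_semicircle : continuous (fun x : R => Num.sqrt (1 - x ^+ 2)).
Proof.
move=> x; apply: (@continuous_comp _ _ _ (fun x : R => 1 - x ^+ 2) Num.sqrt).
  by apply: cvgB; [exact: cvg_cst|exact: exprn_continuous].
exact: sqrt_continuous.
Qed.

Lemma semicircle_integrable (p : {poly R}) :
  mu.-integrable `[-1, 1] (EFin \o (fun x => Num.sqrt (1 - x ^+ 2) * p.[x])).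
Proof.
apply: continuous_itv_integrable => x.
by apply: cvgM; [exact: continuous_semicircle|exact: continuous_horner].
Qed.

Lemma semicircleD p q : semicircle (p + q) = semicircle p + semicircle q.
Proof.
rewrite /semicircle -RintegralD //; try exact: semicircle_integrable.
by apply: eq_Rintegral => x _; rewrite hornerD mulrDr.
Qed.

Lemma semicircleZ a p : semicircle (a *: p) = a * semicircle p.
Proof.
rewrite /semicircle -RintegralZl //; last exact: semicircle_integrable.
by apply: eq_Rintegral => x _; rewrite hornerZ mulrCA.
Qed.

(** The substitution x = - cos y; the sign keeps it increasing on [0, pi]. *)
Lemma semicircle_cos p : semicircle p =
  \int[mu]_(x in `[0, pi]) (sin x ^+ 2 * p.[- cos x]).
Proof.
have pi0 : (0 : R) < pi by exact: pi_gt0.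
pose F (x : R) := - cos x.
have dF (x : R) : is_derive x 1 F (sin x).
  by rewrite /F; apply: is_derive_eq; rewrite opprK.
have dFE : derive1 F = sin.
  by apply/funext => x; rewrite derive1E; exact: (@derive_val _ _ _ _ _ _ _ (dF x)).
have cF : continuous F.
  by move=> x; apply: cvgN; exact: continuous_cos.
have F0 : F 0 = -1 by rewrite /F cos0.
have Fpi : F pi = 1 by rewrite /F cospi opprK.
have := @integration_by_substitution_increasing _ F
  (fun x => Num.sqrt (1 - x ^+ 2) * p.[x]) 0 pi.
rewrite F0 Fpi dFE /semicircle /Rintegral => ->.
- congr fine; apply: eq_integral => x; rewrite inE /= in_itv /= => xpi.
  rewrite !fctE /= /F sqrrN -sin2cos2 sqrtr_sqr ger0_norm ?sin_ge0_pi //.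
  by rewrite expr2; congr (_%:E); ring.
- exact: ltW.
- by move=> x y x0 y0 xy; rewrite /F ltrN2 ltr_cos.
- by move=> x _; exact: continuous_sin.
- apply/cvg_ex; exists (sin 0).
  by apply: cvg_at_right_filter; exact: continuous_sin.
- apply/cvg_ex; exists (sin pi).
  by apply: cvg_at_left_filter; exact: continuous_sin.
- split.
  + by move=> x _; exact: (@ex_derive _ _ _ _ _ _ _ (dF x)).
  + by apply: cvg_at_right_filter; exact: cF.
  + by apply: cvg_at_left_filter; exact: cF.
- apply: continuous_subspaceT => x.
  by apply: cvgM; [exact: continuous_semicircle|exact: continuous_horner].
Qed.

(** Chebyshev polynomials of the second kind, evaluated at -'X.  The index is
    shifted by one, [cheb i.+1] being the polynomial of degree [i], so that the
    recursion starts from [cheb 0 = 0]; pairs of consecutive values make it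
    structural. *)
Fixpoint cheb2 (i : nat) : {poly R} * {poly R} :=
  if i is j.+1 then ((cheb2 j).2, - (2%:R *: 'X) * (cheb2 j).2 - (cheb2 j).1)
  else (0, 1).
Definition cheb i := (cheb2 i).1.

Lemma chebSS i : cheb i.+2 = - (2%:R *: 'X) * cheb i.+1 - cheb i.
Proof. by []. Qed.

Lemma cheb_cos i x : sin x * (cheb i).[- cos x] = sin (i%:R * x).
Proof.
suff : sin x * (cheb i).[- cos x] = sin (i%:R * x) /\
       sin x * (cheb i.+1).[- cos x] = sin (i.+1%:R * x) by case.
elim: i => [|i [IH1 IH2]].
  by rewrite /cheb /= horner0 mulr0 mul0r sin0 hornerC mulr1 mul1r.
split=> //; rewrite chebSS !hornerE mulrBr IH1.
rewrite (_ : sin x * _ = 2 * cos x * (sin x * (cheb i.+1).[- cos x])); last by ring.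
rewrite IH2.
have -> : i.+2%:R * x = i.+1%:R * x + x by rewrite -[i.+2%:R]natr1; ring.
have -> : i%:R * x = i.+1%:R * x - x by rewrite -natr1; ring.
by rewrite sinB sinD; ring.
Qed.

(** Orthogonality to the constants: after the substitution the integrand is
    sin y * sin((i+1) y), a difference of two cosines. *)
Lemma semicircle_cheb i : semicircle (cheb i.+1) = if i == 0%N then pi / 2 else 0.
Proof.
rewrite semicircle_cos.
transitivity (\int[mu]_(x in `[0, pi])
    (2^-1 * (cos (i%:R * x) - cos (i.+2%:R * x)))).
  apply: eq_Rintegral => x _.
  rewrite expr2 -mulrA cheb_cos.
  have -> : i.+2%:R * x = i.+1%:R * x + x by rewrite -[i.+2%:R]natr1; ring.
  have -> : i%:R * x = i.+1%:R * x - x by rewrite -natr1; ring.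
  by rewrite cosB cosD; lra.
have cc (k : nat) : continuous (fun x : R => cos (k%:R * x)).
  move=> x; apply: (@continuous_comp _ _ _ (fun x : R => k%:R * x) cos).
    by apply: cvgM; [exact: cvg_cst|exact: cvg_id].
  exact: continuous_cos.
have ic (k : nat) : mu.-integrable `[0, pi] (EFin \o (fun x => cos (k%:R * x))).
  exact: continuous_itv_integrable.
rewrite RintegralZl //; last first.
  by apply: continuous_itv_integrable => x; apply: cvgB; exact: cc.
rewrite RintegralB //; try exact: ic.
rewrite !cos_natmul_integral /= subr0; case: eqP => _; last by rewrite mulr0.
by rewrite mulrC.
Qed.

Lemma semicircle0 : semicircle 0 = 0.
Proof. by rewrite -[X in semicircle X](scale0r (0 : {poly R})) semicircleZ mul0r. Qed.

Lemma semicircle_sum (I : Type) (r : seq I) (p : I -> {poly R}) :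
  semicircle (\sum_(i <- r) p i) = \sum_(i <- r) semicircle (p i).
Proof.
elim: r => [|i r IH]; first by rewrite !big_nil semicircle0.
by rewrite !big_cons semicircleD IH.
Qed.

Section survival.
Variables u z d s r : R.
Hypotheses (uzd : u + z + d = 1) (ur : u * r = s) (sr : s * r = d).

Let L : {poly R} := z%:P - s *: (2%:R *: 'X).

Let S n i := \sum_(k < n) semicircle (L ^+ k * cheb i).

Let S0 n : S n 0 = 0.
Proof. by rewrite /S big1 // => k _; rewrite /cheb /= mulr0 semicircle0. Qed.

Let SS n i : S n.+1 i.+1 =
  semicircle (cheb i.+1) + z * S n i.+1 + s * S n i.+2 + s * S n i.
Proof.
rewrite /S big_ord_recl expr0 mul1r -!addrA; congr (_ + _).
rewrite !big_distrr -!big_split /=; apply: eq_bigr => k _.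
rewrite -!semicircleZ -!semicircleD /bump /= add1n exprS; congr semicircle.
move: (L ^+ k) => q; rewrite chebSS /L -!(mul_polyC z) -!(mul_polyC s).
move: (cheb i.+1) (cheb i) (2%:R *: 'X) => c1 c0 X2.
by ring.
Qed.

(** The probability of first going below 0 at step [k.+1], from height [i], is
    (2 / pi) d r^i times the integral of [L ^+ k * cheb i.+1] against the
    semicircle: the three-term recursion of the Chebyshev polynomials is the
    one-step recursion of the walk, [cheb 0 = 0] is the boundary condition at
    -1, and orthogonality gives the case k = 0. *)
Lemma surv_semicircle_gen n i :
  surv u z d n i = 1 - 2 / pi * d * r ^+ i * S n i.+1.
Proof.
have pi0 : (pi : R) != 0 by rewrite gt_eqF // pi_gt0.
elim: n i => [|n IH] i; first by rewrite /S big_ord0 mulr0 subr0.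
have zE : z = 1 - u - d by rewrite -uzd; ring.
rewrite /= SS !IH semicircle_cheb; case: i => [|i] /=.
  rewrite S0 zE -ur !expr0 expr1; move: (pi : R) pi0 => p p0; by field.
rewrite IH zE -ur.
have -> : d = u * r * r by rewrite ur.
rewrite !exprS; move: (pi : R) pi0 => p p0; by field.
Qed.

End survival.

(** The integral is symmetric in [u] and [d]. *)
Lemma surv_semicircle (u z d : R) n : 0 < u -> 0 < d -> u + z + d = 1 ->
  surv u z d n 0 = 1 - 2 / pi * d *
    \int[mu]_(x in `[-1, 1])
      (Num.sqrt (1 - x ^+ 2) *
       \sum_(k < n) (z - 2 * Num.sqrt (u * d) * x) ^+ k).
Proof.
move=> u0 d0 uzd; pose s := Num.sqrt (u * d).
have ss : s * s = u * d by rewrite -expr2 sqr_sqrtr // ltW // mulr_gt0.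
have un0 : u != 0 by rewrite gt_eqF.
rewrite (@surv_semicircle_gen u z d s (s / u)) //; last 2 first.
- by rewrite mulrC divfK.
- by rewrite mulrA ss mulrAC divff // mul1r.
rewrite expr0 mulr1 -semicircle_sum; congr (_ - _ * _); apply: eq_Rintegral => x _.
congr (_ * _); rewrite horner_sum; apply: eq_bigr => k _.
by rewrite /cheb /= mulr1 !hornerE /= -/s [2 * s]mulrC.
Qed.

End semicircle.

(** * Convergence tools *)

Section bounded_convergence.
Context d (T : measurableType d) (R : realType).
Variables (mu : {measure set T -> \bar R}) (D : set T) (mD : measurable D).
Hypothesis muD : (mu D < +oo)%E.
Variables (f_ : (T -> R)^nat) (f : T -> R) (M : R).
Hypothesis mf_ : forall n, measurable_fun D (f_ n).
Hypothesis f_f : forall x, D x -> f_ ^~ x @ \oo --> f x.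
Hypothesis f_M : forall n x, D x -> `|f_ n x| <= M.

Lemma bounded_cvg_measurable : measurable_fun D f.
Proof. exact: (measurable_realfun.measurable_fun_cvg mf_). Qed.

Lemma bounded_measurable_integrable (g : T -> R) (C : R) :
  measurable_fun D g -> (forall x, D x -> `|g x| <= C) ->
  mu.-integrable D (EFin \o g).
Proof.
move=> mg gC; apply: measurable_bounded_integrable => //.
by exists C; split; [exact: num_real|move=> y Cy x /= Dx; rewrite (le_trans (gC _ Dx)) // ltW].
Qed.

Lemma bounded_cvg_bound x : D x -> `|f x| <= M.
Proof.
move=> Dx; have h : (fun n => `|f_ n x|) @ \oo --> `|f x|.
  by apply: cvg_norm; exact: f_f.
rewrite -(cvg_lim (@Rhausdorff R) h); apply: limr_le.
  by apply/cvg_ex; exists `|f x|.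
by near=> n; exact: f_M.
Unshelve. all: by end_near. Qed.

Lemma bounded_cvg_integrable : mu.-integrable D (EFin \o f).
Proof.
apply: (@bounded_measurable_integrable _ M); first exact: bounded_cvg_measurable.
exact: bounded_cvg_bound.
Qed.

Lemma bounded_cvg_Rintegral :
  \int[mu]_(x in D) f_ n x @[n --> \oo] --> \int[mu]_(x in D) f x.
Proof.
apply: fine_cvg; rewrite fineK; last first.
  by apply: integrable_fin_num => //; exact: bounded_cvg_integrable.
apply: (@dominated_cvg _ _ _ mu D mD (fun n x => (f_ n x)%:E) (EFin \o f)
  (EFin \o cst M)).
- by move=> n; apply/measurable_EFinP; exact: mf_.
- by move=> x Dx; apply/cvg_EFin; [near=> n|exact: f_f].
- by [].
- apply: measurable_bounded_integrable => //.
  by exists `|M|; split; [exact: num_real|move=> y Cy x /= Dx; exact: ltW].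
- by move=> n x Dx /=; rewrite lee_fin f_M.
Unshelve. all: by end_near. Qed.

End bounded_convergence.

Lemma lebesgue_segment_lty {R : realType} (a b : R) :
  (@lebesgue_measure R `[a, b] < +oo)%E.
Proof.
by rewrite lebesgue_measure_itv /=; case: ifP => _; rewrite ?ltry // -EFinB ltry.
Qed.

Section exponential_limits.
Context {R : realType}.

(** The squeeze uses exp(- a / (1 - a)) <= 1 - a <= exp(- a), both of which are
    instances of 1 + x <= exp x. *)
Lemma cvg_expr_expR (a : nat -> R) (K : nat -> nat) (l : R) :
  (forall n, 0 <= a n) -> a @ \oo --> 0 ->
  (fun n => (K n)%:R * a n) @ \oo --> l ->
  (fun n => (1 - a n) ^+ K n) @ \oo --> expR (- l).
Proof.
move=> a0 acvg Kacvg.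
apply: (@squeeze_cvgr _ _ _ _
  (fun n => expR (- ((K n)%:R * a n / (1 - a n)))) (fun n => expR (- ((K n)%:R * a n)))).
- have a1 : \forall n \near \oo, a n < 1 by apply: (cvgr_lt 0).
  near=> n; have an1 : 0 < 1 - a n by rewrite subr_gt0; near: n.
  have e x : expR (- ((K n)%:R * x)) = expR (- x) ^+ K n.
    by rewrite -expRM_natl mulrN.
  rewrite -mulrA !e; apply/andP; split; apply: lerXn2r;
    rewrite ?nnegrE ?expR_ge0 ?(ltW an1) //; last exact: expR_ge1Dx.
  rewrite expRN -[leRHS]invrK lef_pV2 ?posrE ?expR_gt0 ?invr_gt0 //.
  apply: le_trans (expR_ge1Dx _); rewrite le_eqVlt; apply/orP; left; apply/eqP.
  by field; rewrite gt_eqF.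
- have -> : l = l / (1 - 0) by rewrite subr0 divr1.
  apply: continuous_cvg; first exact: continuous_expR.
  apply: cvgN; apply: cvgM => //; apply: cvgV; first by rewrite subr0 oner_neq0.
  by apply: cvgB => //; exact: cvg_cst.
- apply: continuous_cvg; first exact: continuous_expR.
  exact: cvgN.
Unshelve. all: by end_near. Qed.

(** Squeezed between b / (1 + b x) and b. *)
Lemma cvg_expR_quot (b : R) (x : nat -> R) :
  0 < b -> (forall n, 0 < x n) -> x @ \oo --> 0 ->
  (fun n => (1 - expR (- b * x n)) / x n) @ \oo --> b.
Proof.
move=> b0 x0 xcvg.
apply: (@squeeze_cvgr _ _ _ _ (fun n => b / (1 + b * x n)) (fun n => b)).
- near=> n.
  have bx : 0 < b * x n by rewrite mulr_gt0.
  apply/andP; split.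
    rewrite ler_pdivlMr // mulrAC ler_pdivrMr; last by rewrite addr_gt0.
    rewrite mulNr expRN.
    have h : (expR (b * x n))^-1 <= (1 + b * x n)^-1.
      by rewrite lef_pV2 ?posrE ?expR_gt0 ?addr_gt0 // expR_ge1Dx.
    apply: (@le_trans _ _ ((1 - (1 + b * x n)^-1) * (1 + b * x n))).
      by rewrite mulrBl mul1r mulVf ?gt_eqF ?addr_gt0 //; lra.
    by rewrite ler_wpM2r ?lerB // addr_ge0 // ltW.
  rewrite ler_pdivrMr // lerBlDr -lerBlDl; apply: le_trans (expR_ge1Dx _).
  by rewrite mulNr.
- suff : (fun n => b / (1 + b * x n)) @ \oo --> b / (1 + b * 0).
    by rewrite mulr0 addr0 divr1.
  apply: cvgM; first exact: cvg_cst.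
  apply: cvgV; first by rewrite mulr0 addr0 oner_neq0.
  apply: cvgD; first exact: cvg_cst.
  by apply: cvgM => //; exact: cvg_cst.
- exact: cvg_cst.
Unshelve. all: by end_near. Qed.

End exponential_limits.

(** * Small mesh limit of the survival probabilities *)

Section symbol.
Context {R : realType}.
Implicit Types lambda beta x : R.

(** The limit of the rescaled symbol 1 - (z - 2 sqrt(u d) x) of the walk, when
    [u] and [d] are asymptotic to [beta] and [lambda] times the mesh. *)
Definition kappa (beta lambda x : R) : R :=
  lambda + beta + 2 * Num.sqrt (beta * lambda) * x.

Lemma sqrtM2_le beta lambda : 0 <= beta -> 0 <= lambda ->
  2 * Num.sqrt (beta * lambda) <= lambda + beta.
Proof.
move=> b0 l0; rewrite sqrtrM //.
have := sqr_ge0 (Num.sqrt lambda - Num.sqrt beta).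
rewrite sqrrB !sqr_sqrtr //; lra.
Qed.

Lemma kappa_ge0 beta lambda x : 0 <= beta -> 0 <= lambda -> -1 <= x ->
  0 <= kappa beta lambda x.
Proof.
move=> b0 l0 x1; have := sqrtM2_le b0 l0; rewrite /kappa.
have := sqrtr_ge0 (beta * lambda); set s := Num.sqrt _; nra.
Qed.

Lemma kappa_gt0 beta lambda x : 0 < beta -> 0 < lambda -> -1 < x ->
  0 < kappa beta lambda x.
Proof.
move=> b0 l0 x1; have := sqrtM2_le (ltW b0) (ltW l0); rewrite /kappa.
have : 0 < Num.sqrt (beta * lambda) by rewrite sqrtr_gt0 mulr_gt0.
set s := Num.sqrt _; nra.
Qed.

(** Up to the factor 2 lambda / pi, the probability that the limit walk, with
    up rate [beta] and down rate [lambda], goes below its starting point before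
    time [s]. *)
Definition passage (beta lambda s : R) : R :=
  \int[@lebesgue_measure R]_(x in `[-1, 1])
    (Num.sqrt (1 - x ^+ 2) *
     ((1 - expR (- (s * kappa beta lambda x))) / kappa beta lambda x)).

End symbol.

Section survival_limit.
Context {R : realType}.
Local Notation mu := (@lebesgue_measure R).
Variables (lambda beta t s : R) (u z d h : nat -> R) (K : nat -> nat).
Hypotheses (lambda0 : 0 < lambda) (beta0 : 0 < beta).
Hypotheses (u0 : forall n, 0 < u n) (z0 : forall n, 0 < z n)
  (d0 : forall n, 0 < d n) (uzd : forall n, u n + z n + d n = 1).
Hypotheses (h0 : forall n, 0 < h n) (hcvg : h @ \oo --> 0).
Hypotheses (ucvg : (fun n => u n / h n) @ \oo --> beta)
  (dcvg : (fun n => d n / h n) @ \oo --> lambda).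
Hypotheses (Kt : forall n, (K n)%:R * h n <= t)
  (Kcvg : (fun n => (K n)%:R * h n) @ \oo --> s).

Let kap n (x : R) := kappa (u n / h n) (d n / h n) x.

Let kap_cvg x : kap ^~ x @ \oo --> kappa beta lambda x.
Proof.
apply: cvgD; first exact: cvgD.
apply: cvgM; last exact: cvg_cst.
apply: cvgM; first exact: cvg_cst.
by apply: continuous_cvg; [exact: sqrt_continuous|exact: cvgM].
Qed.

Let symbolE n x : z n - 2 * Num.sqrt (u n * d n) * x = 1 - h n * kap n x.
Proof.
have e : Num.sqrt (u n * d n) = h n * Num.sqrt (u n / h n * (d n / h n)).
  have hn : h n != 0 by rewrite gt_eqF.
  have -> : u n * d n = h n ^+ 2 * (u n / h n * (d n / h n)) by field.
  rewrite sqrtrM ?sqr_ge0 // sqrtr_sqr gtr0_norm //.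
have -> : z n = 1 - u n - d n by rewrite -(uzd n); ring.
by rewrite /kap /kappa e; field; rewrite gt_eqF.
Qed.

Let f n x := Num.sqrt (1 - x ^+ 2) *
  (h n * \sum_(k < K n) (z n - 2 * Num.sqrt (u n * d n) * x) ^+ k).

Let f_cvg x : -1 <= x <= 1 -> f ^~ x @ \oo --> Num.sqrt (1 - x ^+ 2) *
     ((1 - expR (- (s * kappa beta lambda x))) / kappa beta lambda x).
Proof.
move=> /andP[xN1 x1].
(* [kappa] may vanish at -1, where the square root does. *)
have [->|xn1] := eqVneq x (-1).
  rewrite /f sqrrN expr1n subrr sqrtr0 mul0r.
  by under eq_fun do rewrite mul0r; exact: cvg_cst.
have {}xN1 : -1 < x by rewrite lt_neqAle eq_sym xn1.
have k0 : 0 < kappa beta lambda x by exact: kappa_gt0.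
have kn0 n : 0 <= kap n x.
  by apply: kappa_ge0; rewrite ?divr_ge0 // ltW.
apply: cvgM; first exact: cvg_cst.
suff h1 : (fun n => (1 - (1 - h n * kap n x) ^+ K n) / kap n x) @ \oo -->
   (1 - expR (- (s * kappa beta lambda x))) / kappa beta lambda x.
  apply: cvg_trans h1; apply: near_eq_cvg; near=> n.
  have kp : 0 < kap n x.
    by near: n; apply: (cvgr_gt (kappa beta lambda x)).
  under eq_bigr do rewrite symbolE.
  rewrite -[1 - _ ^+ _]opprB subrX1; field.
  by rewrite gt_eqF.
apply: cvgM; last by apply: cvgV; [rewrite gt_eqF|exact: kap_cvg].
apply: cvgB; first exact: cvg_cst.
apply: cvg_expr_expR.
- by move=> n; rewrite mulr_ge0 // ltW.
- by rewrite -(mul0r (kappa beta lambda x)); apply: cvgM => //; exact: kap_cvg.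
- under eq_fun do rewrite mulrA.
  by apply: cvgM => //; exact: kap_cvg.
Unshelve. all: by end_near. Qed.

Let f_bnd n x : -1 <= x <= 1 -> `|f n x| <= t.
Proof.
move=> /andP[xN1 x1]; rewrite /f normrM ger0_norm ?sqrtr_ge0 //.
have s1 : Num.sqrt (1 - x ^+ 2) <= 1.
  by rewrite -[leRHS]sqrtr1 ler_sqrt // gerBl sqr_ge0.
apply: le_trans (Kt n); rewrite -[leRHS]mul1r ler_pM ?sqrtr_ge0 //.
rewrite normrM (gtr0_norm (h0 n)) mulrC ler_wpM2r ?(ltW (h0 n)) //.
apply: le_trans (ler_norm_sum _ _ _) _.
rewrite -[X in _ <= X%:R]card_ord -sum1_card natr_sum; apply: ler_sum => k _.
rewrite normrX; apply: exprn_ile1 => //.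
have := sqrtM2_le (ltW (u0 n)) (ltW (d0 n)).
have := sqrtr_ge0 (u n * d n); have := uzd n; have := z0 n.
rewrite ler_norml; set q := Num.sqrt _ => zp uu q0 q1.
by apply/andP; split; nra.
Qed.

Let g n x := \sum_(k < K n) (z n - 2 * Num.sqrt (u n * d n) * x) ^+ k.

Let g_continuous n : continuous (g n).
Proof.
have -> : g n =
   horner (\sum_(k < K n) ((z n)%:P - (2 * Num.sqrt (u n * d n)) *: 'X) ^+ k).
  apply/funext => y; rewrite horner_sum; apply: eq_bigr => k _.
  by rewrite !hornerE.
exact: continuous_horner.
Qed.

Let f_continuous n : continuous (f n).
Proof.
move=> x; apply: cvgM; first exact: continuous_semicircle.
by apply: cvgM; [exact: cvg_cst|exact: g_continuous].
Qed.

Lemma passage_integral_cvg :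
  (fun n => \int[mu]_(x in `[-1, 1]) f n x) @ \oo --> passage beta lambda s.
Proof.
apply: (@bounded_cvg_Rintegral _ _ _ mu _ _ _ f _ t) => //.
- exact: lebesgue_segment_lty.
- move=> n; apply: measurable_funTS; apply: continuous_measurable_fun.
  exact: f_continuous.
Qed.

Lemma surv_cvg : (fun n => surv (u n) (z n) (d n) (K n) 0) @ \oo -->
  1 - 2 / pi * lambda * passage beta lambda s.
Proof.
have e n : surv (u n) (z n) (d n) (K n) 0 =
    1 - 2 / pi * (d n / h n) * \int[mu]_(x in `[-1, 1]) f n x.
  rewrite surv_semicircle //; congr (_ - _).
  rewrite /f; under [in RHS]eq_Rintegral do rewrite mulrCA.
  rewrite RintegralZl //; last first.
    apply: continuous_itv_integrable => x.
    apply: cvgM; first exact: continuous_semicircle.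
    exact: g_continuous.
  move: (Rintegral _ _ _) (pi : R) => I p; rewrite -!mulrA; do 2 congr (_ * _).
  by field; rewrite gt_eqF.
under eq_fun do rewrite e.
apply: cvgB; first exact: cvg_cst.
apply: cvgM; last exact: passage_integral_cvg.
by apply: cvgM => //; exact: cvg_cst.
Qed.

End survival_limit.

(** * The explicit formula for the survival probability *)

Section poisson_kernel.
Context {R : realType}.
Local Notation mu := (@lebesgue_measure R).

Lemma sqrt_cheb_le1 i (x : R) : -1 <= x <= 1 ->
  `|Num.sqrt (1 - x ^+ 2) * (cheb i).[x]| <= 1.
Proof.
move=> x1; have x1' : -1 <= - x <= 1 by lra.
have -> : x = - cos (acos (- x)) by rewrite acosK ?opprK // in_itv.
have s0 : 0 <= sin (acos (- x)) by rewrite sin_ge0_pi // acos_ge0 // acos_lepi.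
by rewrite sqrrN -sin2cos2 sqrtr_sqr (ger0_norm s0) cheb_cos sin_max.
Qed.

(** Finite form of the generating function of the Chebyshev polynomials; the sum
    telescopes by the three-term recursion. *)
Lemma cheb_geometric (r x : R) n :
  (1 + 2 * r * x + r ^+ 2) * \sum_(k < n) r ^+ k * (cheb k.+1).[x] =
  1 - r ^+ n * (cheb n.+1).[x] + r ^+ n.+1 * (cheb n).[x].
Proof.
elim: n => [|n IH].
  rewrite big_ord0 mulr0 /cheb /= horner0 mulr0 addr0 hornerC expr0 mulr1.
  by rewrite subrr.
rewrite big_ord_recr mulrDr IH chebSS !hornerE !exprS /=; ring.
Qed.

(** Integrate the generating function term by term: only the term k = 0
    survives, by orthogonality. *)
Lemma poisson_kernel_lt1 (r : R) : 0 < r < 1 ->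
  \int[mu]_(x in `[-1, 1])
    (Num.sqrt (1 - x ^+ 2) / (1 + 2 * r * x + r ^+ 2)) = pi / 2.
Proof.
move=> /andP[r0 r1].
pose f n (x : R) := Num.sqrt (1 - x ^+ 2) * \sum_(k < n) r ^+ k * (cheb k.+1).[x].
pose p n : {poly R} := \sum_(k < n) r ^+ k *: cheb k.+1.
have fp n : f n = fun x => Num.sqrt (1 - x ^+ 2) * (p n).[x].
  apply/funext => x; rewrite /f horner_sum; congr (_ * _).
  by apply: eq_bigr => k _; rewrite hornerZ.
have intf n : \int[mu]_(x in `[-1, 1]) f n.+1 x = pi / 2.
  rewrite fp; transitivity (semicircle (p n.+1)) => //.
  rewrite semicircle_sum big_ord_recl semicircleZ semicircle_cheb big1 ?addr0 ?expr0 ?mul1r //.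
  by move=> k _; rewrite semicircleZ semicircle_cheb /= mulr0.
have D0 x : -1 <= x -> 0 < 1 + 2 * r * x + r ^+ 2.
  move=> x1; have : 0 < (1 - r) ^+ 2 by rewrite exprn_gt0 // subr_gt0.
  by nra.
have cvf x : -1 <= x <= 1 ->
    f ^~ x @ \oo --> Num.sqrt (1 - x ^+ 2) / (1 + 2 * r * x + r ^+ 2).
  move=> x1; have Dx : 0 < 1 + 2 * r * x + r ^+ 2 by apply: D0; lra.
  have fE n : f n x = (Num.sqrt (1 - x ^+ 2) -
      r ^+ n * (Num.sqrt (1 - x ^+ 2) * (cheb n.+1).[x]) +
      r ^+ n.+1 * (Num.sqrt (1 - x ^+ 2) * (cheb n).[x])) / (1 + 2 * r * x + r ^+ 2).
    have := cheb_geometric r x n; rewrite /f; set S := \sum_(k < n) _ => eS.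
    apply: (mulIf (lt0r_neq0 Dx)); rewrite divfK ?gt_eqF //.
    transitivity (Num.sqrt (1 - x ^+ 2) * ((1 + 2 * r * x + r ^+ 2) * S)).
      by ring.
    by rewrite eS; ring.
  under eq_fun do rewrite fE.
  apply: cvgM; last exact: cvg_cst.
  have cr (g : nat -> R) (m : nat -> nat) : (forall n, (n <= m n)%N) ->
      (forall n, `|g n| <= 1) -> (fun n => r ^+ m n * g n) @ \oo --> 0.
    move=> hm hg; apply: (@squeeze_cvgr _ _ _ _ (fun n => - r ^+ n) (fun n => r ^+ n)).
    - near=> n; rewrite -ler_norml normrM.
      rewrite (ger0_norm (exprn_ge0 _ (ltW r0))) -[leRHS]mulr1 ler_pM ?exprn_ge0 ?(ltW r0) //.
      by rewrite ler_wiXn2l // ltW.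
    - rewrite -oppr0; apply: cvgN; apply: cvg_expr; by rewrite gtr0_norm.
    - by apply: cvg_expr; rewrite gtr0_norm.
  rewrite -[X in _ --> X]addr0; apply: cvgD; last by apply: cr => // n; exact: sqrt_cheb_le1.
  rewrite -[X in _ --> X]subr0; apply: cvgB; first exact: cvg_cst.
  by apply: cr => // n; exact: sqrt_cheb_le1.
have bf n x : -1 <= x <= 1 -> `|f n x| <= (1 - r)^-1.
  move=> x1; rewrite /f big_distrr /=; apply: le_trans (ler_norm_sum _ _ _) _.
  apply: (@le_trans _ _ (\sum_(k < n) r ^+ k)).
    apply: ler_sum => k _; rewrite mulrCA normrM.
    rewrite (ger0_norm (exprn_ge0 _ (ltW r0))) -[leRHS]mulr1 ler_pM ?exprn_ge0 ?(ltW r0) //.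
    exact: sqrt_cheb_le1.
  have := subrX1 r n; set S := \sum_(k < n) _ => eS.
  rewrite -[leRHS]mul1r ler_pdivlMr ?subr_gt0 //.
  have : 0 <= r ^+ n by rewrite exprn_ge0 // ltW.
  by move: eS; set q := r ^+ n; nra.
have h : (fun n => \int[mu]_(x in `[-1, 1]) f n x) @ \oo -->
   \int[mu]_(x in `[-1, 1]) (Num.sqrt (1 - x ^+ 2) / (1 + 2 * r * x + r ^+ 2)).
  apply: (@bounded_cvg_Rintegral _ _ _ mu _ _ _ f _ (1 - r)^-1) => //.
  - exact: lebesgue_segment_lty.
  - move=> n; apply: measurable_funTS; apply: continuous_measurable_fun.
    rewrite fp => x; apply: cvgM; first exact: continuous_semicircle.
    exact: continuous_horner.
move: h; rewrite -cvg_shiftS /=.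
under eq_fun do rewrite intf.
move=> h; apply: norm_cvg_unique h _; exact: cvg_cst.
Unshelve. all: by end_near. Qed.

Lemma continuous_poisson_kernel (r : R) : 0 < r < 1 ->
  {within `[-1, 1], continuous
    (fun x : R => Num.sqrt (1 - x ^+ 2) / (1 + 2 * r * x + r ^+ 2))}.
Proof.
move=> /andP[r0 r1]; apply: continuous_in_subspaceT => x.
rewrite inE /= in_itv /= => /andP[xN1 x1].
have D0 : 0 < 1 + 2 * r * x + r ^+ 2.
  have : 0 < (1 - r) ^+ 2 by rewrite exprn_gt0 // subr_gt0.
  by nra.
apply: cvgM; first exact: continuous_semicircle.
apply: cvgV; first by rewrite gt_eqF.
apply: cvgD; last exact: cvg_cst.
apply: cvgD; first exact: cvg_cst.
by apply: cvgM; [exact: cvg_cst|exact: cvg_id].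
Qed.

(** The kernel is singular at -1 for r = 1.  After multiplication by r it equals
    sqrt(1 - x^2) / (r + 1 / r + 2 x), which increases with r < 1, so monotone
    convergence extends the previous integral. *)
Lemma poisson_kernel1 :
  (\int[mu]_(x in `[(-1)%R, 1%R])
    (Num.sqrt (1 - x ^+ 2) / (2 + 2 * x))%:E = (pi / 2)%:E)%E.
Proof.
pose r n : R := n.+1%:R / n.+2%:R.
have r01 n : 0 < r n < 1.
  by rewrite divr_gt0 //= ltr_pdivrMr // mul1r ltr_nat ltnSn.
have r0 n : 0 < r n by have /andP[] := r01 n.
have r1 n : r n < 1 by have /andP[] := r01 n.
have rcvg : r @ \oo --> (1 : R).
  have rE n : r n = 1 - harmonic n.+1.
    rewrite /r /harmonic /= -[n.+2%:R]natr1; field.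
    by rewrite addrC !nat1r pnatr_eq0.
  have -> : r = (fun n => 1 - harmonic n.+1) by apply/funext => n; exact: rE.
  rewrite -[X in _ --> X]subr0; apply: cvgB; first exact: cvg_cst.
  have := @cvg_harmonic R; rewrite -cvg_shiftS; exact.
have rmono n m : (n <= m)%N -> r n <= r m.
  move=> nm; rewrite ler_pdivrMr // mulrAC ler_pdivlMr // -!natrM ler_nat; nia.
have D0 n x : -1 <= x -> 0 < 1 + 2 * r n * x + r n ^+ 2.
  move=> x1; have : 0 < (1 - r n) ^+ 2 by rewrite exprn_gt0 // subr_gt0.
  by have := r0 n; nra.
pose g n (x : R) := r n * (Num.sqrt (1 - x ^+ 2) / (1 + 2 * r n * x + r n ^+ 2)).
have gcvg x : -1 <= x <= 1 -> g ^~ x @ \oo --> Num.sqrt (1 - x ^+ 2) / (2 + 2 * x).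
  move=> /andP[xN1 x1]; have [->|xn1] := eqVneq x (-1).
    rewrite /g sqrrN expr1n subrr sqrtr0 mul0r.
    by under eq_fun do rewrite mul0r mulr0; exact: cvg_cst.
  have {}xN1 : -1 < x by rewrite lt_neqAle eq_sym xn1.
  rewrite -[X in _ --> X]mul1r; apply: cvgM => //; apply: cvgM; first exact: cvg_cst.
  apply: cvgV; first by rewrite gt_eqF //; lra.
  have -> : 2 + 2 * x = 1 + 2 * 1 * x + 1 ^+ 2 by ring.
  apply: cvgD; last by rewrite !expr2; apply: cvgM.
  apply: cvgD; first exact: cvg_cst.
  apply: cvgM; last exact: cvg_cst.
  by apply: cvgM => //; exact: cvg_cst.
have intg n : (\int[mu]_(x in `[(-1)%R, 1%R]) (g n x)%:E = (r n * (pi / 2))%:E)%E.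
  have ik : mu.-integrable `[-1, 1] (EFin \o (fun x : R =>
      Num.sqrt (1 - x ^+ 2) / (1 + 2 * r n * x + r n ^+ 2))).
    apply: continuous_compact_integrable; first exact: segment_compact.
    exact: continuous_poisson_kernel.
  under eq_integral do rewrite EFinM.
  rewrite integralZl // [RHS]EFinM; congr (_ * _)%E.
  rewrite -(poisson_kernel_lt1 (r01 n)) /Rintegral fineK //.
  exact: integrable_fin_num.
have h : (fun n => \int[mu]_(x in `[(-1)%R, 1%R]) (g n x)%:E)%E @ \oo -->
    (\int[mu]_(x in `[(-1)%R, 1%R]) (limn (fun n => (g n x)%:E)))%E.
  apply: (@cvg_monotone_convergence _ _ _ mu `[-1, 1] _ (fun n x => (g n x)%:E)) => //.
  - move=> n; apply/measurable_EFinP.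
    apply: measurable_funM => //.
    apply: subspace_continuous_measurable_fun => //.
    exact: continuous_poisson_kernel.
  - move=> n x /=; rewrite in_itv /= => /andP[xN1 x1]; rewrite lee_fin.
    apply: mulr_ge0; first exact: ltW.
    by apply: divr_ge0; [exact: sqrtr_ge0|exact/ltW/D0].
  - move=> x /=; rewrite in_itv /= => /andP[xN1 x1] n m nm; rewrite lee_fin.
    rewrite /g !(mulrCA (r _)) ler_wpM2l ?sqrtr_ge0 //.
    rewrite ler_pdivrMr ?D0 // mulrAC ler_pdivlMr ?D0 //.
    have := rmono _ _ nm; have := r0 n; have := r0 m; have := r1 n; have := r1 m.
    move: (r n) (r m) => a b b1 a1 b0 a0 ab.
    rewrite -subr_ge0 (_ : _ - _ = (b - a) * (1 - a * b)); last by ring.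
    by rewrite mulr_ge0 // subr_ge0 //; nra.
have -> : (\int[mu]_(x in `[(-1)%R, 1%R]) (Num.sqrt (1 - x ^+ 2) / (2 + 2 * x))%:E =
   \int[mu]_(x in `[(-1)%R, 1%R]) (limn (fun n => (g n x)%:E)))%E.
  apply: eq_integral => x; rewrite inE /= in_itv /= => x1.
  apply/esym/cvg_lim => //; apply/cvg_EFin; [exact: nearW|exact: gcvg].
move: h; under eq_fun do rewrite intg.
move=> h; apply: (cvg_unique _ h) => //.
apply/cvg_EFin; first exact: nearW.
rewrite -[X in _ --> X]mul1r; apply: cvgM => //; exact: cvg_cst.
Qed.

Lemma poisson_kernel (r : R) : 0 < r <= 1 ->
  mu.-integrable `[-1, 1] (EFin \o (fun x : R =>
    Num.sqrt (1 - x ^+ 2) / (1 + 2 * r * x + r ^+ 2))) /\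
  \int[mu]_(x in `[-1, 1])
    (Num.sqrt (1 - x ^+ 2) / (1 + 2 * r * x + r ^+ 2)) = pi / 2.
Proof.
move=> /andP[r0]; rewrite le_eqVlt => /predU1P[->|r1]; last first.
  have r01 : 0 < r < 1 by rewrite r0.
  split; last exact: poisson_kernel_lt1.
  apply: continuous_compact_integrable; first exact: segment_compact.
  exact: continuous_poisson_kernel.
have e x : 1 + 2 * 1 * x + 1 ^+ 2 = 2 + 2 * x :> R by ring.
have -> : (fun x : R => Num.sqrt (1 - x ^+ 2) / (1 + 2 * 1 * x + 1 ^+ 2)) =
    (fun x => Num.sqrt (1 - x ^+ 2) / (2 + 2 * x)).
  by apply/funext => x; rewrite e.
split; last by rewrite /Rintegral poisson_kernel1.
have f0 (x : R) : -1 <= x <= 1 -> 0 <= Num.sqrt (1 - x ^+ 2) / (2 + 2 * x).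
  by move=> /andP[xN1 x1]; rewrite divr_ge0 ?sqrtr_ge0 //; lra.
apply/integrableP; split; last first.
  apply: le_lt_trans (ltry (pi / 2)); rewrite -poisson_kernel1.
  rewrite le_eqVlt; apply/orP; left; apply/eqP; apply: eq_integral => x.
  by rewrite inE /= in_itv /= => x1; rewrite ger0_norm // f0.
apply/measurable_EFinP.
apply: (@measurable_fun_cvg _ _ _ _ (fun n (x : R) =>
  Num.sqrt (1 - x ^+ 2) / (2 + 2 * x + n.+1%:R^-1))).
  move=> n; apply: subspace_continuous_measurable_fun => //.
  apply: continuous_in_subspaceT => x.
  rewrite inE /= in_itv /= => /andP[xN1 x1].
  apply: cvgM; first exact: continuous_semicircle.
  apply: cvgV.
    have : 0 < n.+1%:R^-1 :> R by rewrite invr_gt0.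
    by move: (n.+1%:R^-1) => q h; rewrite gt_eqF //; lra.
  apply: cvgD; last exact: cvg_cst.
  apply: cvgD; first exact: cvg_cst.
  by apply: cvgM; [exact: cvg_cst|exact: cvg_id].
move=> x /=; rewrite in_itv /= => /andP[xN1 x1].
have [->|xn1] := eqVneq x (-1).
  rewrite sqrrN expr1n subrr sqrtr0 mul0r.
  by under eq_fun do rewrite mul0r; exact: cvg_cst.
have {}xN1 : -1 < x by rewrite lt_neqAle eq_sym xn1.
apply: cvgM; first exact: cvg_cst.
apply: cvgV; first by rewrite gt_eqF //; lra.
rewrite -[X in _ --> X]addr0; apply: cvgD; first exact: cvg_cst.
exact: cvg_harmonic.
Qed.

(** Factoring out the larger of the two rates leaves a parameter r at most 1. *)
Lemma kappa_poisson (beta lambda : R) : 0 < beta -> 0 < lambda ->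
  let r := Num.sqrt (Num.min beta lambda / Num.max beta lambda) in
  0 < r <= 1 /\
  kappa beta lambda = (fun x => Num.max beta lambda * (1 + 2 * r * x + r ^+ 2)).
Proof.
wlog bl : beta lambda / beta <= lambda => [hw b0 l0|b0 l0] /=.
  have [bl|lb] := leP beta lambda.
    by have := hw _ _ bl b0 l0; rewrite /= min_l // max_r.
  have := hw _ _ (ltW lb) l0 b0; rewrite /= min_l ?(ltW lb) // max_r ?(ltW lb) //.
  move=> [h1 <-]; split => //; apply/funext => x.
  by rewrite /kappa (mulrC lambda) (addrC lambda).
rewrite min_l // max_r //; split.
  rewrite sqrtr_gt0 divr_gt0 //= -[leRHS]sqrtr1 ler_sqrt // ler_pdivrMr //.
  by rewrite mul1r.
have e : Num.sqrt (beta * lambda) = lambda * Num.sqrt (beta / lambda).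
  have -> : beta * lambda = lambda ^+ 2 * (beta / lambda) by field; rewrite gt_eqF.
  by rewrite sqrtrM ?sqr_ge0 // sqrtr_sqr gtr0_norm.
apply/funext => x; rewrite /kappa e sqr_sqrtr ?divr_ge0 ?(ltW b0) ?(ltW l0) //.
by field; rewrite gt_eqF.
Qed.

Lemma kappa_inv_integral (beta lambda : R) : 0 < beta -> 0 < lambda ->
  mu.-integrable `[-1, 1]
    (EFin \o (fun x => Num.sqrt (1 - x ^+ 2) / kappa beta lambda x)) /\
  \int[mu]_(x in `[-1, 1]) (Num.sqrt (1 - x ^+ 2) / kappa beta lambda x) =
    (Num.max beta lambda)^-1 * (pi / 2).
Proof.
move=> b0 l0; have [r01 kE] := kappa_poisson b0 l0.
move: r01 kE; set r := Num.sqrt _ => r01 kE.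
have [ik <-] := poisson_kernel r01.
have -> : (fun x => Num.sqrt (1 - x ^+ 2) / kappa beta lambda x) =
    (fun x => (Num.max beta lambda)^-1 *
      (Num.sqrt (1 - x ^+ 2) / (1 + 2 * r * x + r ^+ 2))).
  by apply/funext => x; rewrite kE invfM mulrCA.
split; last by rewrite RintegralZl.
have := @integrableZl _ _ _ mu `[-1, 1] (measurable_itv _) (Num.max beta lambda)^-1 _ ik.
by apply: eq_integrable => // x _; rewrite /= EFinM.
Qed.

End poisson_kernel.

Section survival_probability.
Context {R : realType}.
Local Notation mu := (@lebesgue_measure R).

(** Separating 1 from exp(- s kappa) in [passage] gives the two terms of [a_]:
    the first is 1 - min(1, lambda / (c alpha)) by the Poisson kernel. *)
Lemma a_E (c lambda alpha s : R) : 0 < c -> 0 < lambda -> 0 < alpha -> 0 <= s ->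
  a_ c lambda alpha s = 1 - 2 / pi * lambda * passage (c * alpha) lambda s.
Proof.
move=> c0 l0 al0 s0; have b0 : 0 < c * alpha by rewrite mulr_gt0.
rewrite /a_ /passage; move: (c * alpha) b0 => beta b0 {c c0 alpha al0}.
have [ik Jk] := kappa_inv_integral b0 l0.
pose q (x : R) := Num.sqrt (1 - x ^+ 2) / kappa beta lambda x * expR (- (s * kappa beta lambda x)).
have iq : mu.-integrable `[-1, 1] (EFin \o q).
  apply: (le_integrable _ _ _ ik) => //.
    apply/measurable_EFinP; apply: measurable_funM.
      by apply/measurable_EFinP; exact: (measurable_int mu).
    apply: measurable_funTS; apply: continuous_measurable_fun => x.
    apply: continuous_cvg; first exact: continuous_expR.
    apply: cvgN; apply: cvgM; first exact: cvg_cst.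
    apply: cvgD; first exact: cvg_cst.
    by apply: cvgM; [exact: cvg_cst|exact: cvg_id].
  move=> x /=; rewrite in_itv /= => /andP[xN1 x1].
  rewrite lee_fin normrM -[leRHS]mulr1 ler_wpM2l // ger0_norm ?expR_ge0 //.
  by rewrite -expR0 ler_expR oppr_le0 mulr_ge0 // kappa_ge0 // ltW.
have -> : \int[mu]_(x in `[-1, 1]) (Num.sqrt (1 - x ^+ 2) *
     ((1 - expR (- (s * kappa beta lambda x))) / kappa beta lambda x)) =
   (Num.max beta lambda)^-1 * (pi / 2) - \int[mu]_(x in `[-1, 1]) q x.
  rewrite -Jk -RintegralB //; apply: eq_Rintegral => x _.
  by rewrite /q mulrA mulrBr mulr1 mulrBl mulrAC.
have -> : \int[mu]_(x in `[-1, 1]) (Num.sqrt (1 - x ^+ 2) /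
      (lambda + beta + 2 * Num.sqrt (beta * lambda) * x) *
      expR (- 2 * Num.sqrt (beta * lambda) * s * x)) =
   expR ((lambda + beta) * s) * \int[mu]_(x in `[-1, 1]) q x.
  rewrite -RintegralZl //; apply: eq_Rintegral => x _.
  rewrite /q mulrCA -expRD /kappa; congr (_ * expR _).
  by ring.
set Q := \int[mu]_(x in _) q x.
have EE : expR (- (lambda + beta) * s) * expR ((lambda + beta) * s) = 1.
  by rewrite -expRD mulNr addNr expR0.
rewrite (_ : 2 * lambda / pi * _ * _ = 2 * lambda / pi * Q); last first.
  by rewrite -mulrA [X in _ * X]mulrA EE mul1r.
move: Q (gt_eqF (pi_gt0 R)) => Q /negbT; move: (pi : R) => p p0.
have [lb|bl] := leP lambda beta.
  rewrite max_l ?max_l //; last by rewrite subr_ge0 ler_pdivrMr // mul1r.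
  by field; rewrite p0 gt_eqF.
rewrite max_r; last by rewrite subr_le0 ler_pdivlMr // mul1r ltW.
by field; rewrite p0 gt_eqF.
Qed.

End survival_probability.

(** * Riemann sums and the occupation time of a path *)

Lemma bounded_ae_cvg_Rintegral d (T : measurableType d) (R : realType)
    (mu : {measure set T -> \bar R}) (D : set T) (f_ : (T -> R)^nat)
    (f : T -> R) (M : R) :
  measurable D -> (mu D < +oo)%E ->
  (forall n, measurable_fun D (f_ n)) -> measurable_fun D f ->
  {ae mu, forall x, D x -> f_ ^~ x @ \oo --> f x} ->
  (forall n x, D x -> `|f_ n x| <= M) -> (forall x, D x -> `|f x| <= M) ->
  \int[mu]_(x in D) f_ n x @[n --> \oo] --> \int[mu]_(x in D) f x.
Proof.
move=> mD muD mf_ mf f_f f_M f_bnd.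
apply: fine_cvg; rewrite fineK; last first.
  by apply: integrable_fin_num => //; exact: bounded_measurable_integrable f_bnd.
have [] // := @dominated_convergence _ _ _ mu D mD (fun n x => (f_ n x)%:E)
  (EFin \o f) (EFin \o cst M).
- by move=> n; apply/measurable_EFinP; exact: mf_.
- exact/measurable_EFinP.
- apply: filterS f_f => x h Dx.
  by apply/cvg_EFin; [exact: nearW|exact: h].
- apply: (@bounded_measurable_integrable _ _ _ mu D mD muD _ `|M|) => //.
- by apply: aeW => x n Dx /=; rewrite lee_fin f_M.
Qed.

Section riemann_sums.
Context {R : realType}.
Local Notation mu := (@lebesgue_measure R).
Variables (t : R) (t0 : 0 < t).

Definition mesh (n : nat) : R := t / n.+1%:R.

Lemma mesh_gt0 n : 0 < mesh n.
Proof. by rewrite divr_gt0. Qed.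

Lemma mesh_cvg0 : mesh @ \oo --> 0.
Proof.
rewrite -(mulr0 t); apply: cvgM; first exact: cvg_cst.
exact: cvg_harmonic.
Qed.

Lemma meshE n : n.+1%:R * mesh n = t.
Proof. by rewrite /mesh mulrC divfK. Qed.

Definition cell n (s : R) : nat := Num.truncn (s / mesh n).

Lemma cell_itv n s : 0 <= s ->
  (cell n s)%:R * mesh n <= s < (cell n s).+1%:R * mesh n.
Proof.
move=> s0; have := mesh_gt0 n => h0.
rewrite -ler_pdivlMr // -ltr_pdivrMr //; apply: truncn_itv.
by rewrite divr_ge0 // ltW.
Qed.

Lemma cell_lt n s : 0 <= s < t -> (cell n s < n.+1)%N.
Proof.
move=> /andP[s0 st]; have /andP[h _] := cell_itv n s0.
have h0 := mesh_gt0 n.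
by rewrite -(ltr_nat R) -(ltr_pM2r h0) meshE (le_lt_trans h).
Qed.

Lemma cell_eq n s k : 0 <= s -> (k%:R * mesh n <= s < k.+1%:R * mesh n) = (k == cell n s).
Proof.
move=> s0; have h0 := mesh_gt0 n; have /andP[h1 h2] := cell_itv n s0.
apply/idP/eqP => [/andP[k1 k2]|->]; last by rewrite h1 h2.
apply/eqP; rewrite eqn_leq; apply/andP; split; rewrite -ltnS -(ltr_nat R) -(ltr_pM2r h0).
  exact: le_lt_trans k1 h2.
exact: le_lt_trans h1 k2.
Qed.

Lemma cell_cvg s : 0 <= s -> (fun n => (cell n s)%:R * mesh n) @ \oo --> s.
Proof.
move=> s0; apply: (@squeeze_cvgr _ _ _ _ (fun n => s - mesh n) (fun=> s)).
- near=> n; have /andP[h1 h2] := cell_itv n s0; rewrite h1 andbT.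
  by move: h2; rewrite -natr1 mulrDl mul1r -ltrBlDr => /ltW.
- rewrite -[X in _ --> X]subr0; apply: cvgB; first exact: cvg_cst.
  exact: mesh_cvg0.
- exact: cvg_cst.
Unshelve. all: by end_near. Qed.

Definition step_function n (phi : nat -> R) (s : R) : R :=
  \sum_(k < n.+1) phi k * \1_(`[k%:R * mesh n, k.+1%:R * mesh n[ : set R) s.

Lemma measurable_step_function n phi (D : set R) : measurable_fun D (step_function n phi).
Proof.
by apply: measurable_sum => k; apply: measurable_funM.
Qed.

Lemma step_functionE n phi s : 0 <= s < t -> step_function n phi s = phi (cell n s).
Proof.
move=> s0t; have /andP[s0 st] := s0t.
rewrite /step_function (bigD1 (Ordinal (cell_lt n s0t))) //= big1 ?addr0.
  by rewrite indicE mem_set ?mulr1 //= in_itv /= cell_itv.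
move=> k /negbTE kn; rewrite indicE memNset ?mulr0 //= in_itv /= cell_eq //.
by move/eqP => e; move/eqP: kn; apply; apply/val_inj.
Qed.

Lemma step_function_bound n phi (M : R) s : (forall k, `|phi k| <= M) -> 0 <= s <= t ->
  `|step_function n phi s| <= M.
Proof.
move=> hM /andP[s0]; rewrite le_eqVlt => /predU1P[->|st]; last first.
  by rewrite step_functionE ?s0.
rewrite /step_function big1 ?normr0 ?(le_trans _ (hM 0%N)) // => k _.
rewrite indicE memNset ?mulr0 //= in_itv /= => /andP[_].
by rewrite -[X in X < _](meshE n) ltr_pM2r ?mesh_gt0 // ltr_nat ltnNge ltn_ord.
Qed.

Lemma Rintegral_step_function n phi :
  \int[mu]_(s in `[0, t]) step_function n phi s = mesh n * \sum_(k < n.+1) phi k.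
Proof.
have h0 := mesh_gt0 n.
have ii (k : 'I_n.+1) : mu.-integrable `[0, t]
    (fun s : R => (\1_(`[k%:R * mesh n, k.+1%:R * mesh n[ : set R) s)%:E).
  apply: (@integrableS _ _ _ mu setT) => //.
  exact: integrable_indic_itv.
have indI (k : 'I_n.+1) : (\int[mu]_(s in `[0%R, t])
   (phi k * \1_(`[(k%:R * mesh n)%R, (k.+1%:R * mesh n)%R[ : set R) s)%:E)%E =
   (phi k * mesh n)%:E.
  under eq_integral do rewrite EFinM.
  rewrite integralZl // integral_indic // EFinM; congr (_ * _)%E.
  have <- : mu `[(k%:R * mesh n), (k.+1%:R * mesh n)[ = (mesh n)%:E.
    rewrite lebesgue_measure_itv /= lte_fin ltr_pM2r // ltr_nat ltnSn.
    by rewrite -EFinB -mulrBl -natr1 addrAC subrr add0r mul1r.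
  congr (mu _); apply: setIidl => x /=; rewrite !in_itv /= => /andP[x1 x2].
  rewrite (le_trans _ x1) /=; last by rewrite mulr_ge0 // ltW.
  by rewrite (le_trans (ltW x2)) // -(meshE n) ler_pM2r // ler_nat.
rewrite /Rintegral.
have -> : (\int[mu]_(s in `[0%R, t]) (step_function n phi s)%:E =
   \int[mu]_(s in `[0%R, t]) \sum_(k < n.+1) (phi k *
     \1_(`[(k%:R * mesh n)%R, (k.+1%:R * mesh n)%R[ : set R) s)%:E)%E.
  by apply: eq_integral => x _; rewrite sumEFin.
rewrite integral_sum //.
  by under eq_bigr do rewrite indI; rewrite sumEFin /= -big_distrl mulrC.
move=> k; have := @integrableZl _ _ _ mu `[0, t] (measurable_itv _) (phi k) _ (ii k).
by apply: eq_integrable.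
Qed.

(** The Riemann sums of varying functions, as integrals of step functions to
    which bounded convergence applies. *)
Lemma riemann_cvg (phi : nat -> nat -> R) (F : R -> R) (M : R) :
  (forall n k, `|phi n k| <= M) -> (forall s, `|F s| <= M) ->
  measurable_fun `[0, t] F ->
  {ae mu, forall s, 0 < s < t -> (fun n => phi n (cell n s)) @ \oo --> F s} ->
  (fun n => mesh n * \sum_(k < n.+1) phi n k) @ \oo -->
  \int[mu]_(s in `[0, t]) F s.
Proof.
move=> phiM FM mF phiF.
under eq_fun do rewrite -Rintegral_step_function.
apply: (@bounded_ae_cvg_Rintegral _ _ _ mu _ _ F M) => //.
- exact: lebesgue_segment_lty.
- by move=> n; exact: measurable_step_function.
- have z0 (r : R) : {ae mu, forall s, s != r}.
    exists [set r]; split => //; first exact: lebesgue_measure_set1.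
    by move=> s /= /negP; rewrite negbK => /eqP.
  move: (z0 0) (z0 t) phiF; apply: (@filterS3 _ (almost_everywhere mu)) => s s0 st h /=.
  rewrite in_itv /= => /andP[s0' st'].
  have s0t : 0 < s < t by rewrite !lt_neqAle eq_sym s0 s0' st st'.
  have -> : (fun n => step_function n (phi n) s) = (fun n => phi n (cell n s)).
    by apply/funext => n; rewrite step_functionE //; case/andP: s0t => /ltW -> ->.
  exact: h.
- by move=> n x /=; rewrite in_itv /= => x0; exact: step_function_bound.
Qed.

(** At the end point [t] the value of [F] is arbitrary, but a point is
    measurable. *)
Lemma cell_cvg_measurable (phi : nat -> nat -> R) (F : R -> R) :
  (forall s, 0 <= s < t -> (fun n => phi n (cell n s)) @ \oo --> F s) ->
  measurable_fun `[0, t] F.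
Proof.
move=> h; have : measurable_fun `[0, t[ F.
  apply: (@measurable_fun_cvg _ _ _ _ (fun n => step_function n (phi n))).
    by move=> n; exact: measurable_step_function.
  move=> s /=; rewrite in_itv /= => s0t.
  have -> : (fun n => step_function n (phi n) s) = (fun n => phi n (cell n s)).
    by apply/funext => n; rewrite step_functionE.
  exact: h.
move=> mF; rewrite -(@setUitv1 _ _ (BLeft 0) t true) ?bnd_simp ?ltW //.
by apply/measurable_funU => //; split => //; exact: measurable_fun_set1.
Qed.

End riemann_sums.

Lemma countable_image_nat (T : Type) (f : nat -> T) : countable (f @` [set: nat]).
Proof. exact: (card_le_trans (card_image_le _ _)). Qed.

Section occupation_of_a_path.
Context {R : realType}.
Local Notation mu := (@lebesgue_measure R).
Variables (c t : R) (c0 : 0 < c) (t0 : 0 < t).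
Variables (Nt : R -> nat) (C : nat -> R).
Hypothesis Nt_right_continuous :
  forall s, 0 <= s -> \forall u \near s^'+, Nt u = Nt s.

Let X s := c * s - \sum_(i < Nt s) C i.

(** The right end of the cell [k]: right-continuity of the path applies to it. *)
Definition grid n k : R := k.+1%:R * mesh t n.

Lemma grid_cell_cvg s : 0 <= s -> (fun n => grid n (cell t n s)) @ \oo --> s.
Proof.
move=> s0; rewrite /grid.
have -> : (fun n => (cell t n s).+1%:R * mesh t n) =
   (fun n => (cell t n s)%:R * mesh t n + mesh t n).
  by apply/funext => n; rewrite -natr1 mulrDl mul1r.
rewrite -[X in _ --> X]addr0; apply: cvgD; first exact: cell_cvg.
exact: mesh_cvg0.
Qed.

Lemma grid_cell_gt n s : 0 <= s -> s < grid n (cell t n s).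
Proof. by move=> s0; have /andP[] := cell_itv t0 n s0. Qed.

Lemma Nt_grid_cell s : 0 <= s ->
  \forall n \near \oo, Nt (grid n (cell t n s)) = Nt s.
Proof.
move=> s0; have := Nt_right_continuous s0.
rewrite /at_right near_withinE => h.
have h2 : \forall n \near \oo, s < grid n (cell t n s) ->
    Nt (grid n (cell t n s)) = Nt s by exact: (grid_cell_cvg s0 h).
by apply: filterS h2 => n; apply; exact: grid_cell_gt.
Qed.

Let neg (x : R) : R := (x < 0)%R%:R.

Let neg_bound x : `|neg x| <= 1.
Proof. by rewrite /neg; case: (_ < _) => /=; rewrite ?normr0 ?normr1. Qed.

Let negE x : \1_(`]-oo, 0[ : set R) x = neg x.
Proof.
rewrite indicE /neg; congr (_%:R : R); congr nat_of_bool.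
by apply/idP/idP; rewrite inE /= in_itv.
Qed.

(** The convergence holds at every [s]: the grid point lies to the right of [s],
    where the surplus can only be larger than at [s] until the next claim. *)
Lemma surplus_grid_cvg s : 0 <= s ->
  (fun n => neg (X (grid n (cell t n s)))) @ \oo --> neg (X s).
Proof.
move=> s0; have hN := Nt_grid_cell s0.
have [X0|X0] := leP 0 (X s).
  apply: cvg_near_cst; near=> n.
  rewrite /neg [X s < 0]ltNge X0 /=.
  suff -> : X (grid n (cell t n s)) < 0 = false by [].
  apply/negbTE; rewrite -leNgt /X.
  have -> : Nt (grid n (cell t n s)) = Nt s by near: n.
  apply: (le_trans X0); rewrite lerD2r ler_pM2l //.
  exact/ltW/grid_cell_gt.
apply: cvg_near_cst; near=> n.
rewrite /neg X0 /=.
suff -> : X (grid n (cell t n s)) < 0 by [].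
rewrite /X.
have -> : Nt (grid n (cell t n s)) = Nt s by near: n.
rewrite subr_lt0 -ltr_pdivlMl //; near: n.
apply: (cvgr_lt s (grid_cell_cvg s0)).
by rewrite ltr_pdivlMl // -subr_lt0.
Unshelve. all: by end_near. Qed.

Lemma measurable_neg_surplus : measurable_fun `[0, t] (fun s => neg (X s)).
Proof.
apply: (@cell_cvg_measurable _ t t0 (fun n k => neg (X (grid n k)))).
by move=> s /andP[s0 _]; exact: surplus_grid_cvg.
Qed.

Lemma occupation_grid_cvg :
  (fun n => mesh t n * \sum_(k < n.+1) neg (X (grid n k))) @ \oo -->
  \int[mu]_(s in `[0, t]) \1_(`]-oo, 0[ : set R) (X s).
Proof.
under [X in _ --> X]eq_Rintegral do rewrite negE.
apply: (@riemann_cvg _ t t0 (fun n k => neg (X (grid n k))) _ 1) => //.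
- exact: measurable_neg_surplus.
- by apply: aeW => s /andP[s0 _]; apply: surplus_grid_cvg; exact: ltW.
Qed.

Hypothesis C0 : forall i, 0 <= C i.

(** The claim in units of the income [c * mesh t n] of one step, rounded up; a
    claim that is already a whole number of units is rounded to the next one. *)
Definition claim_units n i : nat := (Num.truncn (C i / (c * mesh t n))).+1.

Lemma claim_units_cvg i :
  (fun n => c * mesh t n * (claim_units n i)%:R) @ \oo --> C i.
Proof.
have ch n : 0 < c * mesh t n by rewrite mulr_gt0 // mesh_gt0.
apply: (@squeeze_cvgr _ _ _ _ (fun=> C i) (fun n => C i + c * mesh t n)).
- near=> n.
  have := @truncn_itv _ (C i / (c * mesh t n)) (divr_ge0 (C0 i) (ltW (ch n))).
  rewrite ler_pdivlMr // ltr_pdivrMr // /claim_units => /andP[h1 h2].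
  rewrite mulrC (ltW h2) /= -natr1 mulrDl mul1r lerD2r //.
- exact: cvg_cst.
- rewrite -[X in _ --> X]addr0; apply: cvgD; first exact: cvg_cst.
  rewrite -(mulr0 c); apply: cvgM; first exact: cvg_cst.
  exact: mesh_cvg0.
Unshelve. all: by end_near. Qed.

(** The sign of the surplus at the grid point [k], in whole units of income. *)
Definition lattice_neg n k : bool :=
  (k.+1 < \sum_(i < Nt (grid n k)) claim_units n i)%N.

Lemma lattice_neg_cvg s : 0 <= s -> X s != 0 ->
  (fun n => (lattice_neg n (cell t n s))%:R : R) @ \oo --> neg (X s).
Proof.
move=> s0 Xn0; have hN := Nt_grid_cell s0.
have ch n : 0 < c * mesh t n by rewrite mulr_gt0 // mesh_gt0.
have h : (fun n => c * grid n (cell t n s) -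
    \sum_(i < Nt s) c * mesh t n * (claim_units n i)%:R) @ \oo --> X s.
  apply: cvgB; first by apply: cvgM; [exact: cvg_cst|exact: grid_cell_cvg].
  elim: (Nt s) => [|j IH].
    by under eq_fun do rewrite big_ord0; rewrite big_ord0; exact: cvg_cst.
  under eq_fun do rewrite big_ord_recr.
  by rewrite big_ord_recr; apply: cvgD => //; exact: claim_units_cvg.
have e n : (lattice_neg n (cell t n s)) = 
  (c * grid n (cell t n s) -
   \sum_(i < Nt (grid n (cell t n s))) c * mesh t n * (claim_units n i)%:R < 0).
  have g : c * grid n (cell t n s) = c * mesh t n * (cell t n s).+1%:R.
    by rewrite /grid; ring.
  by rewrite -big_distrr /= -natr_sum g -mulrBr pmulr_rlt0 // subr_lt0 ltr_nat.
apply: cvg_near_cst.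
have [X0|X0] := ltP (X s) 0.
  near=> n; rewrite /neg X0 e.
  have -> : Nt (grid n (cell t n s)) = Nt s by near: n.
  suff -> : c * grid n (cell t n s) -
    \sum_(i < Nt s) c * mesh t n * (claim_units n i)%:R < 0 by [].
  by near: n; apply: (cvgr_lt _ h).
have {}X0 : 0 < X s by rewrite lt_neqAle eq_sym Xn0.
near=> n; rewrite /neg [X s < 0]ltNge (ltW X0) e.
have -> : Nt (grid n (cell t n s)) = Nt s by near: n.
suff : 0 < c * grid n (cell t n s) -
  \sum_(i < Nt s) c * mesh t n * (claim_units n i)%:R.
  by move=> /ltW; rewrite leNgt => /negbTE ->.
by near: n; apply: (cvgr_gt _ h).
Unshelve. all: by end_near. Qed.

(** A zero of the surplus is one of the countably many times at which the
    income has paid the first j claims. *)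
Lemma surplus_neq0_ae : {ae mu, forall s, X s != 0}.
Proof.
exists ((fun j => (\sum_(i < j) C i) / c) @` [set: nat]); split.
- apply: countable_measurable; first exact: measurable_set1.
  exact: countable_image_nat.
- by apply: countable_lebesgue_measure0; exact: countable_image_nat.
- move=> s /= /negP; rewrite negbK subr_eq0 => /eqP e.
  by exists (Nt s) => //; rewrite -e mulrC mulKf // gt_eqF.
Qed.

Lemma lattice_occupation_cvg :
  (fun n => mesh t n * \sum_(k < n.+1) (lattice_neg n k)%:R) @ \oo -->
  \int[mu]_(s in `[0, t]) \1_(`]-oo, 0[ : set R) (X s).
Proof.
under [X in _ --> X]eq_Rintegral do rewrite negE.
apply: (@riemann_cvg _ t t0 (fun n k => (lattice_neg n k)%:R) _ 1) => //.
- by move=> n k; case: lattice_neg; rewrite ?normr0 ?normr1.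
- exact: measurable_neg_surplus.
- move: surplus_neq0_ae; apply: (@filterS _ (almost_everywhere mu)) => s Xs /andP[s0 _].
  by apply: lattice_neg_cvg => //; exact: ltW.
Qed.

End occupation_of_a_path.

(** * Rounded exponential claims form a Bernoulli process *)

Section exponential_law.
Context {R : realType}.
Variables (rate : R) (rate0 : 0 < rate).

Lemma exponential_prob_tail (a : R) : 0 <= a ->
  exponential_prob rate `[a, +oo[ = (expR (- (rate * a)))%:E.
Proof.
move=> a0.
have sub : `[a, +oo[ `<=` (`[0, +oo[ : set R).
  by move=> x /=; rewrite !in_itv /= !andbT; exact: le_trans.
have cE : continuous (fun x : R => - expR (- rate * x)).
  move=> x; apply: cvgN; apply: continuous_cvg; first exact: continuous_expR.
  by apply: cvgM; [exact: cvg_cst|exact: cvg_id].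
rewrite /exponential_prob (@ge0_continuous_FTC2y _ _ (fun x => - (expR (- rate * x))) _ 0) //.
- by rewrite sub0e EFinN oppeK mulNr.
- by move=> x _; apply: exponential_pdf_ge0; exact: ltW.
- apply: (continuous_subspaceW sub).
  exact: within_continuous_exponential_pdf.
- rewrite -oppr0; apply: cvgN.
  rewrite (_ : (fun x => expR (- rate * x)) =
               (fun z => expR (- z)) \o (fun z => rate * z)); last first.
    by apply: eq_fun => x; rewrite mulNr.
  apply: (@cvg_comp _ _ _ _ _ _ (pinfty_nbhs R)); last exact: cvgr_expR.
  exact: gt0_cvgMry.
- by apply: cvg_at_right_filter; exact: cE.
- move=> z; rewrite in_itv /= andbT => az.
  by apply: derive1_exponential_pdf; rewrite in_itv /= andbT (le_lt_trans a0).
Qed.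

End exponential_law.

Section renewal_cells.
Context {R : realType}.
Variables (h : R) (h0 : 0 < h).

Definition age_cell (a : nat) : set R := `[a%:R * h, a.+1%:R * h[.

(** The successive claims, rounded up, are the gaps of a renewal process.  This
    lists the constraints that put its renewals where [b] says, when the current
    claim already exceeds [a] units: a renewal fixes the size of a claim, and
    the last claim only has to outlast [b]. *)
Fixpoint claim_cells (b : seq bool) (a : nat) : seq (set R) :=
  match b with
  | [::] => [:: `[(a%:R * h), +oo[%classic]
  | true :: b' => age_cell a :: claim_cells b' 0
  | false :: b' => claim_cells b' a.+1
  end.

Lemma measurable_claim_cells b a j : measurable (nth setT (claim_cells b a) j).
Proof.
elim: b a j => [|[] b IH] a j /=; last exact: IH.
  by case: j => [|j] /=; [exact: measurable_itv|rewrite nth_nil].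
by case: j => [|j] /=; [exact: measurable_itv|exact: IH].
Qed.

(** Geometric gaps: every letter of [b] contributes its own factor, the tail
    r^a being carried from one letter to the next. *)
Lemma prod_claim_cells (m : set R -> R) (r : R) b a :
  (forall k, m `[k%:R * h, +oo[%classic = r ^+ k) ->
  (forall k, m (age_cell k) = r ^+ k * (1 - r)) ->
  \prod_(B <- claim_cells b a) m B =
  r ^+ a * \prod_(e <- b) (if e then 1 - r else r).
Proof.
move=> mt mc; elim: b a => [|[] b IH] a /=.
- by rewrite big_seq1 big_nil mulr1 mt.
- by rewrite !big_cons IH mc expr0 mul1r mulrA.
- by rewrite big_cons IH exprSr mulrA.
Qed.

(** The first [j] claims exceed [k] units exactly when fewer than [j] renewals
    took place in the first [k] cells. *)
Lemma renewal_count (C : nat -> R) (b : seq bool) (i a k j : nat) :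
  (forall l, (l < size (claim_cells b a))%N -> nth setT (claim_cells b a) l (C (i + l)%N)) ->
  (k <= size b)%N ->
  (k + a < \sum_(i' < j) (Num.truncn (C (i + i')%N / h)).+1)%N =
  (count_mem true (take k b) < j)%N.
Proof.
have lb x a' : a'%:R * h <= x -> (a' <= Num.truncn (x / h))%N.
  move=> ax; rewrite truncn_ge_nat; first by rewrite ler_pdivlMr.
  by apply: divr_ge0 (ltW h0); apply: le_trans ax; apply: mulr_ge0 (ltW h0).
elim: b i a k j => [|e b IH] i a k j H kb.
  move: kb; rewrite leqn0 => /eqP -> /=; case: j => [|j].
    by rewrite big_ord0.
  have /= := H 0%N isT; rewrite in_itv /= andbT addn0 => /lb h1.
  rewrite big_ord_recl /= addn0 add0n. by rewrite addSn ltnS; apply/esym; rewrite (leq_trans h1) ?leq_addr.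
case: e H kb => H kb.
  have H' l : (l < size (claim_cells b 0))%N -> nth setT (claim_cells b 0) l (C (i.+1 + l)%N).
    by move=> hl; have := H l.+1 hl; rewrite addSnnS.
  have Gi : Num.truncn (C i / h) = a.
    have := H 0%N isT; rewrite /= /age_cell /= in_itv /= addn0 => /andP[h1 h2].
    by apply: truncn_def; rewrite ler_pdivlMr // h1 ltr_pdivrMr.
  case: j => [|j]; first by rewrite big_ord0.
  rewrite big_ord_recl /= addn0 Gi.
  case: k kb => [|k] kb /=; first by rewrite add0n addSn ltnS leq_addr.
  have := IH i.+1 0%N k j H' kb.
  under [in X in X = _ -> _]eq_bigr do rewrite addSnnS.
  rewrite addn0; under [in X in _ -> X]eq_bigr do rewrite /bump /= add1n.
  set S := (\sum_(i0 < j) _)%N; set M := count _ _ => e.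
  by rewrite add1n ltnS -e addSn addnC addSn ltnS ltn_add2l.
case: k kb => [|k] kb /=; last first.
  by have /= := IH i a.+1 k j H kb; rewrite addnS -addSn => ->.
have /= := IH i a.+1 0%N j H isT; rewrite take0 /= !add0n.
case: j => [|j]; first by rewrite big_ord0.
by move=> h1; rewrite -h1; apply/idP/idP; [rewrite h1|apply: leq_trans].
Qed.

End renewal_cells.

(** * Probability of a word *)

Section generated_sigma_algebra.
Context {T : Type} (G : set (set T)).

Lemma sigma_setC A : <<s G >> A -> <<s G >> (~` A).
Proof. by move=> sA; rewrite -setTD; exact: sigma_algebraCD. Qed.

Lemma sigma_setI A B : <<s G >> A -> <<s G >> B -> <<s G >> (A `&` B).
Proof.
move=> mA mB; rewrite -(setCK (A `&` B)) setCI; apply: sigma_setC.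
rewrite -bigcup2E; apply: sigma_algebra_bigcup => -[|[|k]] /=.
- exact: sigma_setC.
- exact: sigma_setC.
- exact: sigma_algebra0.
Qed.

Lemma sigma_bigcap_seq (I : eqType) (r : seq I) (A : I -> set T) :
  (forall i, i \in r -> <<s G >> (A i)) ->
  <<s G >> (\bigcap_(i in [set` r]) A i).
Proof.
elim: r => [|i r IH] mA.
  rewrite (_ : \bigcap_(i in _) _ = ~` set0).
    by apply: sigma_setC; exact: sigma_algebra0.
  by rewrite setC0; apply/seteqP; split.
have -> : \bigcap_(j in [set` i :: r]) A j = A i `&` \bigcap_(j in [set` r]) A j.
  apply/seteqP; split => [x h|x [h1 h2] j /=].
    split; first by apply: h => /=; rewrite mem_head.
    by move=> j /= jr; apply: h => /=; rewrite in_cons jr orbT.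
  by rewrite in_cons => /predU1P[->//|jr]; exact: h2.
apply: sigma_setI; first by apply: mA; rewrite mem_head.
by apply: IH => j jr; apply: mA; rewrite in_cons jr orbT.
Qed.

End generated_sigma_algebra.

Section word_events.
Context {R : realType} {d : measure_display} {Omega : measurableType d}.
Variables (P : probability Omega R) (c lambda alpha : R).
Hypotheses (c0 : 0 < c) (lambda0 : 0 < lambda) (alpha0 : 0 < alpha).
Variables (N : R -> {RV P >-> nat}) (C : nat -> {RV P >-> R}).
Hypotheses (N_poisson : poisson_process lambda N) (C_iid : iid_exponential alpha C).
Hypothesis NC_indep : independent_systems P
       (sigma_process (`[0, +oo[ : set R) (fun t => N t : Omega -> nat))
       (sigma_process [set: nat] (fun i => C i : Omega -> R)).
Variables (delta : R) (delta0 : 0 < delta).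

Definition arrival (e : int) : nat := (e == -1).
Definition renewal (e : int) : bool := (e == 1).

Definition arrivals (s : seq int) : set Omega :=
  \bigcap_(j in [set` iota 0 (size s)])
    (fun w => N (j.+1%:R * delta) w - N (j%:R * delta) w)%N @^-1`
      [set arrival (nth 0 s j)].

Definition cells (s : seq int) := claim_cells (c * delta) (map renewal s) 0.

Definition renewals (s : seq int) : set Omega :=
  \bigcap_(j in [set` iota 0 (size (cells s))]) C j @^-1` nth setT (cells s) j.

Lemma prob_arrivals s : P (arrivals s) =
  (\prod_(e <- s) poisson_pmf (lambda * delta) (arrival e))%:E.
Proof.
have := @pp_indep _ _ _ _ _ _ N_poisson (fun i => i%:R * delta).
rewrite /= mul0r => /(_ (lexx 0)) h.
have mono i : i%:R * delta <= i.+1%:R * delta.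
  by rewrite ler_pM2r // ler_nat.
have {h} := h mono (iota 0 (size s)) (fun j => [set arrival (nth 0 s j)]) (iota_uniq _ _).
move=> -> //; rewrite [in RHS](big_nth 0) -prodEFin /index_iota subn0.
apply: eq_bigr => j _; set A := _ @^-1` _.
have -> : A = [set w | (N (j.+1%:R * delta) w - N (j%:R * delta) w)%N = arrival (nth 0 s j)] by [].
rewrite (pp_increments N_poisson); last 2 first.
- by rewrite mulr_ge0 // ltW.
- by rewrite ltr_pM2r // ltr_nat.
by rewrite -mulrBl -natr1 addrAC subrr add0r mul1r.
Qed.

Lemma prob_claim_tail i (a : R) : 0 <= a ->
  distribution P (C i) `[a, +oo[ = (expR (- (alpha * a)))%:E.
Proof.
by move=> a0; rewrite (iid_law C_iid) // exponential_prob_tail.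
Qed.

Let q := expR (- (alpha * (c * delta))).

Lemma prob_claim_tail_nat i k :
  distribution P (C i) `[(k%:R * (c * delta)), +oo[ = (q ^+ k)%:E.
Proof.
rewrite prob_claim_tail ?mulr_ge0 // ?(ltW c0) ?(ltW delta0) //.
by rewrite /q -expRM_natl; congr (expR _)%:E; ring.
Qed.

Lemma prob_claim_cell i k :
  distribution P (C i) (age_cell (c * delta) k) = (q ^+ k * (1 - q))%:E.
Proof.
have -> : age_cell (c * delta) k =
    `[(k%:R * (c * delta)), +oo[ `\` `[(k.+1%:R * (c * delta)), +oo[.
  apply/seteqP; split => x; rewrite /age_cell /= !in_itv /= !andbT.
    by move=> /andP[h1 h2]; split => //; apply/negP; rewrite -ltNge.
  by move=> [h1 /negP]; rewrite -ltNge => h2; rewrite h1 h2.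
have sub : `[(k.+1%:R * (c * delta)), +oo[ `<=` (`[(k%:R * (c * delta)), +oo[ : set R).
  move=> x /=; rewrite !in_itv /= !andbT; apply: le_trans.
  by rewrite ler_pM2r ?mulr_gt0 // ler_nat.
rewrite measureD //; last exact: (le_lt_trans (probability_le1 _ _) (ltry 1)).
rewrite setIidr //.
transitivity ((q ^+ k)%:E - (q ^+ k.+1)%:E)%E.
  by congr (_ - _)%E; exact: prob_claim_tail_nat.
rewrite -EFinB; congr (_%:E).
by rewrite mulrBr mulr1 exprSr.
Qed.

Lemma prob_renewals s : P (renewals s) =
  (\prod_(e <- s) (if renewal e then 1 - q else q))%:E.
Proof.
have := iid_indep C_iid (iota_uniq 0 (size (cells s)))
   (fun j => measurable_claim_cells (c * delta) (map renewal s) 0 j).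
rewrite /renewals => ->.
pose m B := fine (distribution P (C 0%N) B).
have mE i B : measurable B -> P (C i @^-1` B) = (m B)%:E.
  move=> mB; rewrite /m fineK; last exact: fin_num_measure.
  by rewrite (iid_law C_iid) // -(iid_law C_iid i).
rewrite (eq_bigr (fun j => (m (nth setT (cells s) j))%:E)); last first.
  by move=> j _; rewrite mE //; exact: measurable_claim_cells.
rewrite prodEFin; congr (_%:E).
transitivity (\prod_(B <- cells s) m B).
  by rewrite (big_nth setT) /index_iota subn0.
rewrite (@prod_claim_cells _ _ m q).
- by rewrite expr0 mul1r big_map.
- by move=> k; rewrite /m prob_claim_tail_nat.
- by move=> k; rewrite /m prob_claim_cell.
Qed.

(** The process is observed at single times, so an increment is described by
    the value at its left end. *)
Lemma arrivals_sigma s :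
  sigma_process (`[0, +oo[ : set R) (fun t => N t : Omega -> nat) (arrivals s).
Proof.
apply: sigma_bigcap_seq => j _.
have j1 : 0 <= j.+1%:R * delta by rewrite mulr_ge0 // ltW.
have j0 : 0 <= j%:R * delta by rewrite mulr_ge0 // ltW.
have gen (u : R) k : 0 <= u -> sigma_process (`[0, +oo[ : set R)
    (fun t => N t : Omega -> nat) (N u @^-1` [set k]).
  move=> u0; apply: sub_sigma_algebra; exists u; first by rewrite /= in_itv /= u0.
  by exists [set k] => //; rewrite setTI.
have -> : (fun w => (N (j.+1%:R * delta) w - N (j%:R * delta) w)%N) @^-1`
      [set arrival (nth 0 s j)] =
   \bigcup_m (N (j%:R * delta) @^-1` [set m] `&`
     N (j.+1%:R * delta) @^-1` [set (m + arrival (nth 0%R s j))%N]).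
  apply/seteqP; split => w /=.
    move=> e; exists (N (j%:R * delta) w) => //; split => //=.
    rewrite -e subnKC //; apply: (pp_nondecreasing N_poisson) => //.
    by rewrite ler_pM2r // ler_nat.
  by move=> [m _ /= [-> ->]]; rewrite addKn.
apply: sigma_algebra_bigcup => m; apply: sigma_setI; exact: gen.
Qed.

Lemma renewals_sigma s :
  sigma_process [set: nat] (fun i => C i : Omega -> R) (renewals s).
Proof.
apply: sigma_bigcap_seq => j _; apply: sub_sigma_algebra; exists j => //.
exists (nth setT (cells s) j); first exact: measurable_claim_cells.
by rewrite setTI.
Qed.

(** In each step of a word, either a claim arrives, or a renewal takes place, or
    nothing happens; simultaneous and multiple events are left out. *)
Definition word_event s := arrivals s `&` renewals s.

Definition grid_weight : int -> R :=
  lazy_weight (expR (- (lambda * delta)) * (1 - q))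
    (expR (- (lambda * delta)) * q)
    (lambda * delta * expR (- (lambda * delta)) * q).

Lemma prob_word s : {subset s <= lazy_steps} ->
  P (word_event s) = (\prod_(e <- s) grid_weight e)%:E.
Proof.
move=> sl; rewrite (NC_indep (arrivals_sigma s) (renewals_sigma s)).
rewrite prob_arrivals prob_renewals -EFinM -big_split /=; congr (_%:E).
rewrite big_seq [RHS]big_seq; apply: eq_bigr => e /sl.
have ld : 0 < lambda * delta by rewrite mulr_gt0.
rewrite /poisson_pmf ld /lazy_steps !inE /grid_weight /lazy_weight.
move=> /or3P[] /eqP -> /=; rewrite /arrival /renewal /=.
- by rewrite expr0 fact0 invr1 !mul1r.
- by rewrite expr0 fact0 invr1 !mul1r.
- by rewrite expr1 factS fact0 invr1 !mulr1.
Qed.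

End word_events.

(** * The lattice approximation follows the walk *)

Section words.
Variable steps : seq int.

Fixpoint words n : seq (seq int) :=
  if n is m.+1 then [seq e :: s | e <- steps, s <- words m] else [:: [::]].

Lemma wsum_words (R : comPzRingType) (w : int -> R) n F :
  wsum steps w n F = \sum_(s <- words n) (\prod_(e <- s) w e) * F s.
Proof.
elim: n F => [|n IH] F; first by rewrite /= big_seq1 big_nil mul1r.
rewrite wsumS /= big_allpairs_dep /=; apply: eq_bigr => e _.
rewrite IH big_distrr /=; apply: eq_bigr => s _.
by rewrite big_cons mulrA.
Qed.

Lemma mem_words n s : s \in words n -> size s = n /\ {subset s <= steps}.
Proof.
elim: n s => [|n IH] s /=; first by rewrite inE => /eqP ->.
case/allpairsP => -[e s'] /= [es /IH[<- ss'] ->]; split=> //.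
by move=> x; rewrite inE => /predU1P[->//|]; exact: ss'.
Qed.

Lemma uniq_words n : uniq steps -> uniq (words n).
Proof.
move=> us; elim: n => [//|n IH] /=; apply: allpairs_uniq => //.
by move=> [e s] [e' s'] _ _ /= [-> ->].
Qed.

End words.

Lemma negs_take x s :
  negs x s = (\sum_(k < size s) (x + sumz (take k.+1 s) < 0)%R)%N.
Proof.
elim: s x => [|e s IH] x /=; first by rewrite big_ord0.
rewrite big_ord_recl /= take0 sumz_cons /sumz big_nil addr0 IH.
congr addn; apply: eq_bigr => k _.
by rewrite /bump /= add1n -/(sumz (e :: _)) sumz_cons addrA.
Qed.

Lemma sumz_count s : {subset s <= lazy_steps} ->
  sumz s = (count_mem 1%R s)%:Z - (count_mem (-1)%R s)%:Z.
Proof.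
elim: s => [|e s IH] ss; first by rewrite /sumz big_nil.
rewrite sumz_cons IH /=; last by move=> x xs; apply: ss; rewrite inE xs orbT.
have : e \in lazy_steps by apply: ss; rewrite mem_head.
by rewrite !inE => /or3P[] /eqP -> /=; lia.
Qed.

(** This makes the events of different words disjoint. *)
Lemma sumz_take_inj s s' : size s = size s' ->
  (forall k, (k <= size s)%N -> sumz (take k s) = sumz (take k s')) -> s = s'.
Proof.
move=> ss' h; apply: (@eq_from_nth _ 0) => // k ks.
have := h k.+1 ks; rewrite !(take_nth 0) ?sumz_rcons -?ss' //.
by rewrite h ?(ltnW ks) // => /addrI.
Qed.

Section random_sums.
Context {R : realType} {d : measure_display} {T : measurableType d}.

Lemma measurable_random_sum (M : T -> nat) (X : nat -> T -> R) :
  measurable_fun setT M -> (forall i, measurable_fun setT (X i)) ->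
  measurable_fun setT (fun w => \sum_(i < M w) X i w).
Proof.
move=> mM mX _ Y mY; rewrite setTI.
have -> : (fun w => \sum_(i < M w) X i w) @^-1` Y =
    \bigcup_m (M @^-1` [set m] `&` (fun w => \sum_(i < m) X i w) @^-1` Y).
  apply/seteqP; split => w /=; first by exists (M w).
  by move=> [m _ [/= -> ]].
apply: bigcupT_measurable => m; apply: measurableI.
  by rewrite -[X in measurable X]setTI; apply: mM.
rewrite -[X in measurable X]setTI.
have mS : measurable_fun setT (fun w => \sum_(i < m) X i w).
  by apply: measurable_sum => i; exact: mX.
exact: mS.
Qed.

Lemma measurable_truncn : measurable_fun setT (fun x : R => (Num.truncn x)%:R : R).
Proof.
apply: nondecreasing_measurable => // x y xy.
by rewrite ler_nat le_truncn.
Qed.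

End random_sums.

Section lattice_law.
Context {R : realType} {d : measure_display} {Omega : measurableType d}.
Variables (P : probability Omega R) (c lambda alpha t : R).
Hypotheses (c0 : 0 < c) (lambda0 : 0 < lambda) (alpha0 : 0 < alpha) (t0 : 0 < t).
Variables (N : R -> {RV P >-> nat}) (C : nat -> {RV P >-> R}).
Hypotheses (N_poisson : poisson_process lambda N) (C_iid : iid_exponential alpha C).
Hypothesis NC_indep : independent_systems P
       (sigma_process (`[0, +oo[ : set R) (fun t => N t : Omega -> nat))
       (sigma_process [set: nat] (fun i => C i : Omega -> R)).
Variable n : nat.

Let G s := word_event c N C (mesh t n) s.
Let units i w := claim_units c t (fun i => C i w) n i.

(** The arrivals are the down-steps and the renewals are the up-steps. *)
Lemma word_event_counts s w k : G s w -> (k <= size s)%N ->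
  N (k%:R * mesh t n) w = count_mem (-1)%R (take k s) /\
  forall j, (k < \sum_(i < j) units i w)%N = (count_mem 1%R (take k s) < j)%N.
Proof.
have h0 := mesh_gt0 t0 n.
move=> [GA GR] ks; split.
  elim: k ks => [|k IH] ks; first by rewrite mul0r (pp_start N_poisson) take0.
  have := GA k; rewrite /= mem_iota /= ks => /(_ isT) e.
  rewrite (take_nth 0) // -cats1 count_cat /= addn0 -IH ?(ltnW ks) //.
  rewrite /arrival in e; rewrite -e addnC subnK //.
  apply: (pp_nondecreasing N_poisson); first by rewrite mulr_ge0 // ltW.
  by rewrite ler_pM2r // ler_nat.
move=> j.
have h1 : 0 < c * mesh t n by rewrite mulr_gt0.
have := @renewal_count _ _ h1 (fun i => C i w) (map renewal s) 0 0 k j.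
rewrite addn0 size_map => ->//; last first.
  by move=> l hl; apply: GR; rewrite /= mem_iota.
rewrite -map_take count_map; congr (_ < _)%N; apply: eq_count => x /=.
by rewrite /renewal eqb_id.
Qed.

Definition lattice_count w : nat :=
  \sum_(k < n.+1) lattice_neg c t (fun u => N u w) (fun i => C i w) n k.

Lemma lattice_count_word s w : s \in words lazy_steps n.+1 -> G s w ->
  lattice_count w = negs 0 s.
Proof.
move=> /mem_words[ss sl] Gs; rewrite negs_take ss; apply: eq_bigr => k _.
have ks : (k.+1 <= size s)%N by rewrite ss.
have [Nk Ck] := word_event_counts Gs ks.
rewrite /lattice_neg /grid Nk Ck add0r sumz_count; last first.
  by move=> x /mem_take; exact: sl.
by congr nat_of_bool; rewrite subr_lt0 ltz_nat.
Qed.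

Lemma word_event_inj s s' w : s \in words lazy_steps n.+1 ->
  s' \in words lazy_steps n.+1 -> G s w -> G s' w -> s = s'.
Proof.
move=> /mem_words[ss sl] /mem_words[ss' sl'] Gs Gs'.
apply: sumz_take_inj; first by rewrite ss.
move=> k ks; have ks' : (k <= size s')%N by rewrite ss' -ss.
have [Nk Ck] := word_event_counts Gs ks.
have [Nk' Ck'] := word_event_counts Gs' ks'.
rewrite !sumz_count; [|by move=> x /mem_take; exact: sl'|by move=> x /mem_take; exact: sl].
rewrite -Nk -Nk'; congr (_%:Z - _).
have e j : (count_mem 1%R (take k s) < j)%N = (count_mem 1%R (take k s') < j)%N.
  by rewrite -Ck -Ck'.
apply/eqP; rewrite eqn_leq; apply/andP; split.
  by rewrite -ltnS e.
by rewrite -ltnS -e.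
Qed.

Variables (g : R -> R).
Hypotheses (mg : measurable_fun setT g) (g01 : forall x, 0 <= g x <= 1).

Let W := words lazy_steps n.+1.
Let lo w := \sum_(s <- W) g (negs 0 s)%:R * \1_(G s) w.
Let ind w : R := \sum_(s <- W) \1_(G s) w.

(** At most one word event occurs at [w]; the error is at most the indicator
    that none does. *)
Let sandwich w : lo w <= g (lattice_count w)%:R <= lo w + (1 - ind w).
Proof.
have /andP[g0 g1] := g01 (lattice_count w)%:R.
have [[s0 s0W Gs0]|nG] := pselect (exists2 s, s \in W & G s w).
  have z s : s \in W -> s != s0 -> \1_(G s) w = 0 :> R.
    move=> sW ss0; rewrite indicE memNset // => Gs.
    by move/eqP: ss0; apply; exact: (word_event_inj sW s0W Gs Gs0).
  have uW : uniq W by exact: uniq_words.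
  have -> : lo w = g (lattice_count w)%:R.
    rewrite /lo (bigD1_seq s0) //= indicE mem_set // mulr1 (lattice_count_word s0W Gs0).
    rewrite big_seq_cond big1 ?addr0 // => s /andP[sW ss0].
    by rewrite z ?mulr0.
  have -> : ind w = 1.
    rewrite /ind (bigD1_seq s0) //= indicE mem_set //.
    rewrite big_seq_cond big1 ?addr0 // => s /andP[sW ss0].
    by rewrite z.
  by rewrite subrr addr0 lexx.
have z s : s \in W -> \1_(G s) w = 0 :> R.
  by move=> sW; rewrite indicE memNset // => Gs; apply: nG; exists s.
have -> : lo w = 0 by rewrite /lo big_seq big1 // => s sW; rewrite z ?mulr0.
have -> : ind w = 0 by rewrite /ind big_seq big1 // => s sW; rewrite z.
by rewrite g0 add0r subr0.
Qed.

Lemma measurable_lattice_neg k : measurable_fun setT (fun w =>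
  (lattice_neg c t (fun u => N u w) (fun i => C i w) n k)%:R : R).
Proof.
pose S w : R := \sum_(i < N (grid t n k) w) ((Num.truncn (C i w / (c * mesh t n)))%:R + 1).
have mS : measurable_fun setT S.
  apply: (@measurable_random_sum _ _ _ (N (grid t n k))
    (fun i w => (Num.truncn (C i w / (c * mesh t n)))%:R + 1)) => // i.
  apply: measurable_funD => //.
  have mC : measurable_fun setT (fun w => C i w / (c * mesh t n)).
    by apply: measurable_funM.
  exact: (measurableT_comp measurable_truncn mC).
have -> : (fun w => (lattice_neg c t (fun u => N u w) (fun i => C i w) n k)%:R) =
    (\1_(`]k.+1%:R, +oo[ : set R) : R -> R) \o S.
  apply/funext => w /=; rewrite indicE /lattice_neg; congr (_%:R : R); congr nat_of_bool.
  have -> : S w = (\sum_(i < N (grid t n k) w) claim_units c t (fun i => C i w) n i)%:R.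
    by rewrite natr_sum; apply: eq_bigr => i _; rewrite /claim_units -natr1.
  by apply/idP/idP; rewrite inE /= in_itv /= andbT ltr_nat.
exact: measurableT_comp.
Qed.

Lemma measurable_lattice_count : measurable_fun setT (fun w => (lattice_count w)%:R : R).
Proof.
have -> : (fun w => (lattice_count w)%:R : R) = fun w => \sum_(k < n.+1)
    (lattice_neg c t (fun u => N u w) (fun i => C i w) n k)%:R.
  by apply/funext => w; rewrite natr_sum.
by apply: measurable_sum => k; exact: measurable_lattice_neg.
Qed.

Let mG s : measurable (G s).
Proof.
apply: measurableI; apply: fin_bigcap_measurable => //= j _; last first.
  rewrite -[X in measurable X]setTI; apply: measurable_funPT => //.
  exact: measurable_claim_cells.
have -> : (fun w => (N (j.+1%:R * mesh t n) w - N (j%:R * mesh t n) w)%N) @^-1`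
     [set arrival s`_j] =
   \bigcup_m (N (j%:R * mesh t n) @^-1` [set m] `&`
     N (j.+1%:R * mesh t n) @^-1` [set k | (k - m)%N = arrival s`_j]).
  apply/seteqP; split => w /=; first by move=> e; exists (N (j%:R * mesh t n) w).
  by move=> [m _ /= [-> ]].
apply: bigcupT_measurable => m; apply: measurableI.
  by rewrite -[X in measurable X]setTI; apply: measurable_funPT.
by rewrite -[X in measurable X]setTI; apply: measurable_funPT.
Qed.

Let indicator_sum (r : seq (seq int)) (a : seq int -> R) :
  P.-integrable setT (EFin \o (fun w => \sum_(s <- r) a s * \1_(G s) w)) /\
  \int[P]_w (\sum_(s <- r) a s * \1_(G s) w) = \sum_(s <- r) a s * fine (P (G s)).
Proof.
elim: r => [|s r [IH1 IH2]].
  have -> : (fun w => \sum_(s <- [::]) a s * \1_(G s) w) = cst 0.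
    by apply/funext => w; rewrite big_nil.
  rewrite big_nil; split; first exact: finite_measure_integrable_cst.
  by rewrite Rintegral_cst // mul0r.
have i1 : P.-integrable setT (EFin \o (fun w => \1_(G s) w)) by exact: integrable_indic.
have i2 : P.-integrable setT (EFin \o (fun w => a s * \1_(G s) w)).
  have := @integrableZl _ _ _ P setT measurableT (a s) _ i1.
  by apply: eq_integrable.
have -> : (fun w => \sum_(s <- s :: r) a s * \1_(G s) w) =
    (fun w => a s * \1_(G s) w + \sum_(s <- r) a s * \1_(G s) w).
  by apply/funext => w; rewrite big_cons.
split; first by have := @integrableD _ _ _ P setT measurableT _ _ i2 IH1; apply: eq_integrable.
rewrite RintegralD // IH2 big_cons RintegralZl //; congr (_ * _ + _).
by rewrite /Rintegral integral_indic // setIT.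
Qed.

Local Notation rho := (\sum_(e <- lazy_steps) grid_weight c lambda alpha (mesh t n) e).

Local Notation E0 := (wsum lazy_steps (grid_weight c lambda alpha (mesh t n))
  n.+1 (fun s => g (negs 0 s)%:R)).

(** The word events miss a set of probability [1 - rho ^+ n.+1], the total
    weight of the words being [rho ^+ n.+1]. *)
Lemma lattice_count_expectation :
  E0 <= \int[P]_w g (lattice_count w)%:R <= E0 + (1 - rho ^+ n.+1).
Proof.
have PW a : \sum_(s <- W) a s * fine (P (G s)) =
    wsum lazy_steps (grid_weight c lambda alpha (mesh t n)) n.+1 a.
  rewrite wsum_words big_seq [RHS]big_seq; apply: eq_bigr => s /mem_words[_ sl].
  by rewrite (prob_word c0 lambda0 alpha0 N_poisson C_iid NC_indep) ?mesh_gt0 //= mulrC.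
have [ilo Ilo] := indicator_sum W (fun s => g (negs 0 s)%:R).
have [iind Iind] := indicator_sum W (fun=> 1).
rewrite PW in Ilo; rewrite PW wsum1 in Iind.
have iP : (P setT < +oo)%E by rewrite probability_setT ltry.
have ig : P.-integrable setT (EFin \o (fun w => g (lattice_count w)%:R)).
  apply: (@bounded_measurable_integrable _ _ _ P setT measurableT iP _ 1).
    exact: (measurableT_comp mg measurable_lattice_count).
  by move=> w _; have /andP[g0 g1] := g01 (lattice_count w)%:R; rewrite ger0_norm.
have i1 : P.-integrable setT (EFin \o (fun=> 1 : R)) by exact: finite_measure_integrable_cst.
have iB : P.-integrable setT (EFin \o (fun w => 1 - \sum_(s <- W) 1 * \1_(G s) w)).
  have := @integrableB _ _ _ P setT measurableT _ _ i1 iind.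
  by apply: eq_integrable.
apply/andP; split.
  rewrite -Ilo; apply: le_Rintegral => // w _.
  by have /andP[] := sandwich w.
rewrite -Ilo -Iind.
have e1 : \int[P]_w (1 : R) = 1.
  transitivity (1 * fine (P setT)); first by rewrite Rintegral_cst.
  by rewrite probability_setT mul1r.
rewrite -[X in _ + (X - _)]e1 -RintegralB // -RintegralD //; apply: le_Rintegral => //.
  have := @integrableD _ _ _ P setT measurableT _ _ ilo iB.
  by apply: eq_integrable.
move=> w _; have /andP[_] := sandwich w.
by rewrite /ind; under [in X in _ -> _ <= _ + (_ - X)]eq_bigr do rewrite mul1r.
Qed.

End lattice_law.

(** * Limit of the law of the walk *)

Lemma wsum_scale (R : comPzRingType) (steps : seq int) (w w' : int -> R) r n F :
  (forall e, w' e = r * w e) -> wsum steps w' n F = r ^+ n * wsum steps w n F.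
Proof.
move=> ww'; elim: n F => [|n IH] F; first by rewrite expr0 mul1r.
rewrite !wsumS big_distrr /=; apply: eq_bigr => e _; rewrite IH ww' exprS.
by rewrite mulrACA.
Qed.

Lemma surv01 (R : realDomainType) (u z d : R) n i :
  0 <= u -> 0 <= z -> 0 <= d -> u + z + d = 1 -> 0 <= surv u z d n i <= 1.
Proof.
move=> u0 z0 d0 uzd; elim: n i => [|n IH] i /=; first by rewrite ler01 lexx.
have /andP[a0 a1] := IH i.+1; have /andP[b0 b1] := IH i.
case: i b0 b1 {a0 a1} (conj a0 a1) => [|i] b0 b1 [a0 a1].
  by apply/andP; split; nra.
by have /andP[e0 e1] := IH i; apply/andP; split; nra.
Qed.

Section weights.
Context {R : realType}.
Variables (c lambda alpha t : R).
Hypotheses (c0 : 0 < c) (lambda0 : 0 < lambda) (alpha0 : 0 < alpha) (t0 : 0 < t).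

Let del n : R := mesh t n.
Let q n : R := expR (- (alpha * (c * del n))).
Let e n : R := expR (- (lambda * del n)).

Definition weight_up n : R := e n * (1 - q n).
Definition weight_stay n : R := e n * q n.
Definition weight_down n : R := lambda * del n * e n * q n.
Definition weight_total n : R := weight_up n + weight_stay n + weight_down n.

Let del0 n : 0 < del n. Proof. exact: mesh_gt0. Qed.
Let dcvg : del @ \oo --> (0 : R). Proof. exact: mesh_cvg0. Qed.

Let exp_cvg1 (b : R) : (fun n => expR (- (b * del n))) @ \oo --> (1 : R).
Proof.
rewrite -[X in _ --> X]expR0; apply: continuous_cvg; first exact: continuous_expR.
rewrite -oppr0; apply: cvgN; rewrite -(mulr0 b).
by apply: cvgM => //; exact: cvg_cst.
Qed.

Let ecvg : e @ \oo --> (1 : R). Proof. exact: exp_cvg1. Qed.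

Let qE : q = fun n => expR (- (c * alpha * del n)).
Proof. by apply/funext => n; rewrite /q; congr expR; ring. Qed.

Let qcvg : q @ \oo --> (1 : R). Proof. rewrite qE; exact: exp_cvg1. Qed.

Let e0 n : 0 < e n. Proof. exact: expR_gt0. Qed.
Let q0 n : 0 < q n. Proof. exact: expR_gt0. Qed.
Let q1 n : q n < 1.
Proof. by rewrite -expR0 ltr_expR oppr_lt0 !mulr_gt0. Qed.

Lemma weight_up_gt0 n : 0 < weight_up n. Proof. by rewrite mulr_gt0 // subr_gt0. Qed.
Lemma weight_stay_gt0 n : 0 < weight_stay n. Proof. by rewrite mulr_gt0. Qed.
Lemma weight_down_gt0 n : 0 < weight_down n. Proof. by rewrite !mulr_gt0. Qed.
Lemma weight_total_gt0 n : 0 < weight_total n.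
Proof. by rewrite !addr_gt0 ?weight_up_gt0 ?weight_stay_gt0 ?weight_down_gt0. Qed.

Lemma weight_total_le1 n : weight_total n <= 1.
Proof.
have -> : weight_total n = e n * (1 + lambda * del n * q n).
  by rewrite /weight_total /weight_up /weight_stay /weight_down; ring.
apply: (@le_trans _ _ (e n * expR (lambda * del n))).
  rewrite ler_wpM2l ?(ltW (e0 n)) //; apply: le_trans (expR_ge1Dx _).
  by rewrite lerD2l ler_piMr ?(ltW (q1 n)) // mulr_ge0 // ltW.
by rewrite /e -expRD addNr expR0.
Qed.

Let e_quot : (fun n => (1 - e n) / del n) @ \oo --> lambda.
Proof.
have := @cvg_expR_quot _ lambda del lambda0 del0 dcvg.
by rewrite /e; under eq_fun do rewrite mulNr.
Qed.

Let q_quot : (fun n => (1 - q n) / del n) @ \oo --> c * alpha.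
Proof.
have := @cvg_expR_quot _ (c * alpha) del (mulr_gt0 c0 alpha0) del0 dcvg.
by rewrite qE; under eq_fun do rewrite mulNr.
Qed.

Lemma weight_total_cvg : weight_total @ \oo --> (1 : R).
Proof.
have -> : (1 : R) = 1 * (1 - 1) + 1 * 1 + lambda * 0 * 1 * 1 by ring.
apply: cvgD; first apply: cvgD.
- by apply: cvgM => //; apply: cvgB => //; exact: cvg_cst.
- exact: cvgM.
- by apply: cvgM => //; apply: cvgM => //; apply: cvgM => //; exact: cvg_cst.
Qed.

(** The defect [1 - weight_total n] is of second order in the mesh, since its
    first-order terms, both equal to [lambda] times the mesh, cancel. *)
Lemma weight_total_expr_cvg : (fun n => weight_total n ^+ n.+1) @ \oo --> (1 : R).
Proof.
have := @cvg_expr_expR _ (fun n => 1 - weight_total n) succn 0.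
rewrite oppr0 expR0.
have -> : (fun n => (1 - (1 - weight_total n)) ^+ n.+1) = (fun n => weight_total n ^+ n.+1).
  by apply/funext => n; rewrite subKr.
apply.
- by move=> n; rewrite subr_ge0 weight_total_le1.
- by rewrite -[X in _ --> X](subrr 1); apply: cvgB; [exact: cvg_cst|exact: weight_total_cvg].
have -> : (fun n => n.+1%:R * (1 - weight_total n)) =
    (fun n => t * ((1 - e n) / del n - lambda * (e n * q n))).
  apply/funext => n; have dn : del n != 0 by rewrite gt_eqF.
  by rewrite -{1}(meshE t n) -/(del n) /weight_total /weight_up /weight_stay /weight_down; field.
rewrite -[X in _ --> X](mulr0 t); apply: cvgM; first exact: cvg_cst.
have -> : (0 : R) = lambda - lambda * (1 * 1) by ring.
apply: cvgB => //; apply: cvgM; first exact: cvg_cst.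
exact: cvgM.
Qed.

Definition prob_up n := weight_up n / weight_total n.
Definition prob_stay n := weight_stay n / weight_total n.
Definition prob_down n := weight_down n / weight_total n.

Lemma prob_up_gt0 n : 0 < prob_up n. Proof. by rewrite divr_gt0 ?weight_up_gt0 ?weight_total_gt0. Qed.
Lemma prob_stay_gt0 n : 0 < prob_stay n. Proof. by rewrite divr_gt0 ?weight_stay_gt0 ?weight_total_gt0. Qed.
Lemma prob_down_gt0 n : 0 < prob_down n. Proof. by rewrite divr_gt0 ?weight_down_gt0 ?weight_total_gt0. Qed.
Lemma prob_sum n : prob_up n + prob_stay n + prob_down n = 1.
Proof. by rewrite -!mulrDl divff // gt_eqF // weight_total_gt0. Qed.

Lemma prob_up_cvg : (fun n => prob_up n / del n) @ \oo --> c * alpha.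
Proof.
have -> : (fun n => prob_up n / del n) = (fun n => e n * ((1 - q n) / del n) / weight_total n).
  apply/funext => n; rewrite /prob_up /weight_up; field.
  by rewrite !gt_eqF // weight_total_gt0.
suff h : (fun n => e n * ((1 - q n) / del n) / weight_total n) @ \oo -->
    1 * (c * alpha) / 1 by rewrite mul1r divr1 in h.
apply: cvgM; first exact: cvgM.
by apply: cvgV; [rewrite oner_neq0|exact: weight_total_cvg].
Qed.

Lemma prob_down_quot n : prob_down n / del n = lambda * prob_stay n.
Proof.
rewrite /prob_down /weight_down /prob_stay /weight_stay; field.
by rewrite !gt_eqF // weight_total_gt0.
Qed.

Lemma prob_down_cvg : (fun n => prob_down n / del n) @ \oo --> lambda.
Proof.
under eq_fun do rewrite prob_down_quot.
suff h : (fun n => lambda * prob_stay n) @ \oo --> lambda * (1 * 1 / 1).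
  by rewrite mul1r divr1 mulr1 in h.
apply: cvgM; first exact: cvg_cst.
apply: cvgM; first exact: cvgM.
by apply: cvgV; [rewrite oner_neq0|exact: weight_total_cvg].
Qed.

Lemma grid_weightE n s :
  grid_weight c lambda alpha (mesh t n) s =
  weight_total n * lazy_weight (prob_up n) (prob_stay n) (prob_down n) s.
Proof.
have tn : weight_total n != 0 by rewrite gt_eqF // weight_total_gt0.
by rewrite /grid_weight /lazy_weight; case: ifP => _; [|case: ifP => _];
  rewrite /prob_up /prob_stay /prob_down [RHS]mulrC divfK.
Qed.

Lemma sum_grid_weight n :
  \sum_(s <- lazy_steps) grid_weight c lambda alpha (mesh t n) s = weight_total n.
Proof.
by rewrite /lazy_steps !big_cons big_nil addr0 addrA.
Qed.

End weights.

Lemma wsum_negs (R : comPzRingType) (steps : seq int) (w : int -> R) n (F : nat -> R) :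
  wsum steps w n (fun s => F (negs 0 s)) =
  \sum_(k < n.+1) F k * wsum steps w n (fun s => (negs 0 s == k)%:R).
Proof.
under [RHS]eq_bigr do rewrite -wsumZ.
rewrite -wsum_sum; apply: eq_wsum => s ss.
have h : (negs 0 s < n.+1)%N by rewrite ltnS -ss negs_size.
rewrite (bigD1 (Ordinal h)) //= eqxx mulr1 big1 ?addr0 // => k /negbTE kn.
by rewrite -[X in X == _]/(nat_of_ord (Ordinal h)) eq_sym (_ : (nat_of_ord k == _) = false) ?mulr0.
Qed.

Section limit_law.
Context {R : realType}.
Local Notation mu := (@lebesgue_measure R).
Variables (c lambda alpha t : R).
Hypotheses (c0 : 0 < c) (lambda0 : 0 < lambda) (alpha0 : 0 < alpha) (t0 : 0 < t).

Local Notation u := (prob_up c lambda alpha t).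
Local Notation z := (prob_stay c lambda alpha t).
Local Notation d := (prob_down c lambda alpha t).
Local Notation del := (mesh t).

Let beta := c * alpha.
Let beta0 : 0 < beta. Proof. exact: mulr_gt0. Qed.

(** The limit of q_k as [k] times the mesh tends to [s]. *)
Definition survival (s : R) : R := 1 - 2 / pi * lambda * passage beta lambda s.
(** The limit of p_k divided by the mesh: a first step down, at rate [lambda],
    followed by the reflected walk. *)
Definition below_rate (s : R) : R := lambda * (1 - 2 / pi * beta * passage beta lambda s).

Lemma passageC s : passage lambda beta s = passage beta lambda s.
Proof.
by apply: eq_Rintegral => x _; rewrite /kappa (mulrC beta) (addrC beta).
Qed.

Let u0 n : 0 < u n. Proof. exact: prob_up_gt0. Qed.
Let z0 n : 0 < z n. Proof. exact: prob_stay_gt0. Qed.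
Let d0 n : 0 < d n. Proof. exact: prob_down_gt0. Qed.
Let uzd n : u n + z n + d n = 1. Proof. exact: prob_sum. Qed.
Let dzu n : d n + z n + u n = 1.
Proof. by rewrite -(uzd n); ring. Qed.
Let del0 n : 0 < del n. Proof. exact: mesh_gt0. Qed.

Lemma survival_cvg (K : nat -> nat) s :
  (forall n, (K n <= n.+1)%N) -> (fun n => (K n)%:R * del n) @ \oo --> s ->
  (fun n => surv (u n) (z n) (d n) (K n) 0) @ \oo --> survival s.
Proof.
move=> Kn Ks; apply: (@surv_cvg _ lambda beta t s u z d del K) => //.
- exact: mesh_cvg0.
- exact: prob_up_cvg.
- exact: prob_down_cvg.
- by move=> n; rewrite -[leRHS](meshE t n) ler_pM2r // ler_nat.
Qed.

Lemma below_rate_cvg (K : nat -> nat) s :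
  (forall n, (K n <= n.+1)%N) -> (fun n => (K n)%:R * del n) @ \oo --> s ->
  (fun n => d n / del n * surv (d n) (z n) (u n) (K n) 0) @ \oo --> below_rate s.
Proof.
move=> Kn Ks; apply: cvgM; first exact: prob_down_cvg.
rewrite -passageC; apply: (@surv_cvg _ beta lambda t s d z u del K) => //.
- exact: mesh_cvg0.
- exact: prob_down_cvg.
- exact: prob_up_cvg.
- by move=> n; rewrite -[leRHS](meshE t n) ler_pM2r // ler_nat.
Qed.

Let psi n j : R := d n / del n * surv (d n) (z n) (u n) j 0 *
  surv (u n) (z n) (d n) (n - j) 0.

(* The first factor is [lambda] times a probability. *)
Let psi_bound n j : 0 <= psi n j <= lambda.
Proof.
have /andP[s0 s1] := surv01 n 0 (ltW (u0 n)) (ltW (z0 n)) (ltW (d0 n)) (uzd n).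
have /andP[a0 a1] := surv01 j 0 (ltW (d0 n)) (ltW (z0 n)) (ltW (u0 n)) (dzu n).
have /andP[b0 b1] := surv01 (n - j) 0 (ltW (u0 n)) (ltW (z0 n)) (ltW (d0 n)) (uzd n).
have dd0 : 0 <= d n / del n by rewrite divr_ge0 // ltW.
have dd1 : d n / del n <= lambda.
  rewrite prob_down_quot // ler_piMr ?(ltW lambda0) //.
  have := uzd n; have := u0 n; have := d0 n; lra.
rewrite /psi; apply/andP; split; first by apply: mulr_ge0 => //; exact: mulr_ge0.
rewrite -[leRHS]mulr1; apply: ler_pM => //; first exact: mulr_ge0.
by rewrite -[leRHS]mulr1; apply: ler_pM.
Qed.

Definition raw_density (s : R) : R := below_rate s * survival (t - s).

Let psi_cvg s : 0 <= s < t -> (fun n => psi n (cell t n s)) @ \oo --> raw_density s.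
Proof.
move=> s0t; have /andP[s0 st] := s0t.
have cl n : (cell t n s <= n)%N by rewrite -ltnS; exact: cell_lt.
apply: cvgM.
  apply: below_rate_cvg; first by move=> n; exact: leqW.
  exact: cell_cvg.
apply: survival_cvg; first by move=> n; rewrite (leq_trans (leq_subr _ _)).
have -> : (fun n => (n - cell t n s)%:R * del n) =
   (fun n => t - grid t n (cell t n s)).
  apply/funext => n; have e := meshE t n; rewrite -natr1 in e.
  apply: (addIr (grid t n (cell t n s))); rewrite subrK -[RHS]e natrB // /grid.
  by rewrite -[(cell t n s).+1%:R]natr1; ring.
by apply: cvgB; [exact: cvg_cst|exact: grid_cell_cvg].
Qed.

(** Positivity is inherited from the approximating probabilities. *)
Lemma raw_density_bound s : 0 <= s < t -> 0 <= raw_density s <= lambda.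
Proof.
move=> s0t; have h := psi_cvg s0t.
rewrite -(cvg_lim (@Rhausdorff R) h); apply/andP; split.
  apply: limr_ge; first by apply/cvg_ex; exists (raw_density s).
  by near=> n; have /andP[] := psi_bound n (cell t n s).
apply: limr_le; first by apply/cvg_ex; exists (raw_density s).
by near=> n; have /andP[] := psi_bound n (cell t n s).
Unshelve. all: by end_near. Qed.

Lemma survival_ge0 : 0 <= survival t.
Proof.
have h : (fun n => surv (u n) (z n) (d n) n.+1 0) @ \oo --> survival t.
  apply: survival_cvg => //.
  by under eq_fun do rewrite meshE; exact: cvg_cst.
rewrite -(cvg_lim (@Rhausdorff R) h); apply: limr_ge.
  by apply/cvg_ex; exists (survival t).
near=> n; by have /andP[] := surv01 n.+1 0 (ltW (u0 n)) (ltW (z0 n)) (ltW (d0 n)) (uzd n).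
Unshelve. all: by end_near. Qed.

Definition density : R -> R := raw_density \_ `]0, t[.

Lemma measurable_density : measurable_fun setT density.
Proof.
apply/measurable_restrict => //; rewrite setTI.
apply: (@measurable_funS _ _ _ _ `[0, t]) => //.
  exact: subset_itv_oo_cc.
exact: (cell_cvg_measurable t0 psi_cvg).
Qed.

Lemma densityE s : 0 < s < t -> density s = raw_density s.
Proof. by move=> st; rewrite /density patchE mem_set //= in_itv. Qed.

Lemma density_bound s : 0 <= density s <= lambda.
Proof.
rewrite /density patchE; case: ifPn => [|_]; last by rewrite lexx ltW.
by rewrite inE /= in_itv /= => /andP[s0 st]; apply: raw_density_bound; rewrite (ltW s0).
Qed.

Variables (f : R -> R).
Hypotheses (cf : continuous f) (f01 : forall x, 0 <= f x <= 1).

Let phi n j : R := f (del n * j.+1%:R) * psi n j.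

Lemma wsum_law n :
  wsum lazy_steps (grid_weight c lambda alpha (del n)) n.+1
    (fun s => f (del n * (negs 0 s)%:R)) =
  weight_total c lambda alpha t n ^+ n.+1 *
   (f 0 * surv (u n) (z n) (d n) n.+1 0 + del n * \sum_(j < n.+1) phi n j).
Proof.
rewrite (@wsum_scale _ _ (lazy_weight (u n) (z n) (d n)) _ (weight_total c lambda alpha t n)); last first.
  by move=> e; exact: grid_weightE.
congr (_ * _).
rewrite (wsum_negs _ _ _ (fun k => f (del n * k%:R))).
rewrite big_ord_recl /= mulr0 lsum_negs // mul1r subn0; congr (_ + _).
rewrite big_distrr /=; apply: eq_bigr => j _.
rewrite /bump /= add1n lsum_negs ?ltn_ord // subSS /phi /psi.
by field; rewrite gt_eqF.
Qed.

Lemma wsum_law_cvg :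
  (fun n => wsum lazy_steps (grid_weight c lambda alpha (del n)) n.+1
    (fun s => f (del n * (negs 0 s)%:R))) @ \oo -->
  f 0 * survival t + \int[mu]_(s in `[0, t]) (f s * density s).
Proof.
under eq_fun do rewrite wsum_law.
suff h : (fun n => weight_total c lambda alpha t n ^+ n.+1 *
   (f 0 * surv (u n) (z n) (d n) n.+1 0 + del n * \sum_(j < n.+1) phi n j)) @ \oo -->
   1 * (f 0 * survival t + \int[mu]_(s in `[0, t]) (f s * density s)).
  by rewrite mul1r in h.
apply: cvgM; first exact: weight_total_expr_cvg.
apply: cvgD.
  apply: cvgM; first exact: cvg_cst.
  apply: survival_cvg => //.
  by under eq_fun do rewrite meshE; exact: cvg_cst.
apply: (@riemann_cvg _ t t0 phi (fun s => f s * density s) lambda).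
- move=> n k; have /andP[f0 f1] := f01 (del n * k.+1%:R).
  have /andP[p0 p1] := psi_bound n k.
  rewrite /phi ger0_norm; last exact: mulr_ge0.
  by rewrite -[leRHS]mul1r; apply: ler_pM.
- move=> s; have /andP[f0 f1] := f01 s; have /andP[p0 p1] := density_bound s.
  rewrite ger0_norm; last exact: mulr_ge0.
  by rewrite -[leRHS]mul1r; apply: ler_pM.
- apply: measurable_funM; last by apply: measurable_funTS; exact: measurable_density.
  by apply: measurable_funTS; exact: continuous_measurable_fun.
- apply: aeW => s st; have /andP[s0 st'] := st; rewrite densityE //.
  apply: cvgM; last by apply: psi_cvg; rewrite (ltW s0).
  apply: continuous_cvg; first exact: cf.
  have -> : (fun n => del n * (cell t n s).+1%:R) = (fun n => grid t n (cell t n s)).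
    by apply/funext => n; rewrite mulrC.
  by apply: grid_cell_cvg => //; exact: ltW.
Qed.

End limit_law.

(** * The law of the occupation time *)

Section occupation_law.
Context {R : realType} {d : measure_display} {Omega : measurableType d}.
Local Notation mu := (@lebesgue_measure R).
Variables (P : probability Omega R) (c lambda alpha t : R).
Hypotheses (c0 : 0 < c) (lambda0 : 0 < lambda) (alpha0 : 0 < alpha) (t0 : 0 < t).
Variables (N : R -> {RV P >-> nat}) (C : nat -> {RV P >-> R}).
Hypotheses (N_poisson : poisson_process lambda N) (C_iid : iid_exponential alpha C).
Hypothesis NC_indep : independent_systems P
       (sigma_process (`[0, +oo[ : set R) (fun t => N t : Omega -> nat))
       (sigma_process [set: nat] (fun i => C i : Omega -> R)).

Let occ := occupation_time (surplus c N C) t.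

Lemma measurable_surplus u : measurable_fun setT (surplus c N C u).
Proof.
apply: measurable_funB => //.
exact: (@measurable_random_sum _ _ _ (N u) (fun i => C i)).
Qed.

(** The occupation time is, for every outcome, the limit of the Riemann sums of
    the surplus itself, which are measurable. *)
Lemma measurable_occupation : measurable_fun setT occ.
Proof.
apply: (@measurable_fun_cvg _ _ _ _ (fun n w => mesh t n * \sum_(k < n.+1)
   (surplus c N C (grid t n k) w < 0)%R%:R)).
  move=> n; apply: measurable_funM => //; apply: measurable_sum => k.
  have -> : (fun w => (surplus c N C (grid t n k) w < 0)%R%:R : R) =
      (\1_(`]-oo, 0[ : set R) : R -> R) \o surplus c N C (grid t n k).
    apply/funext => w /=; rewrite indicE; congr (_%:R : R); congr nat_of_bool.
    by apply/idP/idP; rewrite inE /= in_itv.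
  apply: measurableT_comp => //; exact: measurable_surplus.
move=> w _.
apply: (@occupation_grid_cvg _ c t c0 t0 (fun u => N u w) (fun i => C i w)).
by move=> s s0; exact: (pp_right_continuous N_poisson).
Qed.

(** Rounding a negative claim to a positive number of units would not
    approximate it. *)
Lemma claims_ge0_ae : {ae P, forall w, forall i, 0 <= C i w}.
Proof.
have h i : {ae P, forall w, 0 <= C i w}.
  exists (C i @^-1` (~` `[0, +oo[)); split.
  - rewrite -[X in measurable X]setTI; apply: measurable_funPT => //.
    exact: measurableC.
  - apply: (etrans (probability_setC (distribution P (C i))
      (measurable_itv `[0, +oo[))).
    transitivity (1 - 1 : \bar R)%E; last exact: subee.
    congr (_ - _)%E; apply: (etrans (prob_claim_tail alpha0 C_iid i (lexx 0))).
    by rewrite mulr0 oppr0 expR0.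
  - by move=> w /= hw; rewrite in_itv /= andbT.
exact: ae_foralln h.
Qed.

Section test_function.
Variables (f : R -> R).
Hypotheses (cf : continuous f) (f01 : forall x, 0 <= f x <= 1).

Let mf : measurable_fun setT f.
Proof. exact: continuous_measurable_fun. Qed.

Let K n w : R := mesh t n * (lattice_count c t N C n w)%:R.

Let fK_cvg : (fun n => \int[P]_w f (K n w)) @ \oo --> \int[P]_w f (occ w).
Proof.
have PT : (P setT < +oo)%E by rewrite probability_setT ltry.
apply: (@bounded_ae_cvg_Rintegral _ _ _ P setT (fun n w => f (K n w)) _ 1) => //.
- move=> n; apply: (measurableT_comp mf); apply: measurable_funM => //.
  exact: measurable_lattice_count.
- exact: (measurableT_comp mf measurable_occupation).
- apply: filterS claims_ge0_ae => w C0 _.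
  apply: continuous_cvg; first exact: cf.
  have := @lattice_occupation_cvg _ c t c0 t0 (fun u => N u w) (fun i => C i w).
  have rc s : 0 <= s -> \forall u \near s^'+, N u w = N s w.
    by move=> s0; exact: (pp_right_continuous N_poisson).
  move=> /(_ rc C0); rewrite /K /lattice_count.
  by under [in X in _ -> X]eq_fun do rewrite natr_sum.
- by move=> n w _; have /andP[f0 f1] := f01 (K n w); rewrite ger0_norm.
- by move=> w _; have /andP[f0 f1] := f01 (occ w); rewrite ger0_norm.
Qed.

(** Both sides are limits of the expectation of [f] at the rescaled lattice
    count, which the words compute up to a vanishing error. *)
Lemma occupation_test : \int[P]_w f (occ w) =
  f 0 * survival c lambda alpha t +
  \int[mu]_(s in `[0, t]) (f s * density c lambda alpha t s).
Proof.
apply: (norm_cvg_unique fK_cvg).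
have h := wsum_law_cvg c0 lambda0 alpha0 t0 cf f01.
apply: (@squeeze_cvgr _ _ _ _ _ (fun n => wsum lazy_steps
    (grid_weight c lambda alpha (mesh t n)) n.+1
    (fun s => f (mesh t n * (negs 0 s)%:R)) + (1 - weight_total c lambda alpha t n ^+ n.+1))
  _ _ _ h).
- apply: nearW => n.
  have mg : measurable_fun setT (fun x => f (mesh t n * x)).
    by apply: (measurableT_comp mf); apply: measurable_funM.
  have := lattice_count_expectation c0 lambda0 alpha0 t0 N_poisson C_iid NC_indep
    n mg (fun x => f01 (mesh t n * x)).
  by rewrite sum_grid_weight.
- rewrite -[X in _ --> X]addr0; apply: cvgD => //.
  rewrite -[X in _ --> X](subrr 1); apply: cvgB; first exact: cvg_cst.
  exact: weight_total_expr_cvg.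
Qed.

End test_function.

(** Continuous functions that increase to the indicator of the half-line below
    [y]: the base of the power is 1 from [y] on and less than 1 below [y]. *)
Definition ray_test (y : R) (m : nat) (x : R) : R :=
  1 - expR (- (`|y - x| + (y - x))) ^+ m.

Lemma ray_test_continuous y m : continuous (ray_test y m).
Proof.
move=> x; apply: cvgB; first exact: cvg_cst.
apply: (@continuous_comp _ _ _ (fun x => expR (- (`|y - x| + (y - x)))) (fun x => x ^+ m)).
  apply: continuous_cvg; first exact: continuous_expR.
  have yx : y - x0 @[x0 --> x] --> y - x by apply: cvgB; [exact: cvg_cst|exact: cvg_id].
  by apply: cvgN; apply: cvgD => //; exact: cvg_norm.
exact: exprn_continuous.
Qed.

Lemma ray_test01 y m x : 0 <= ray_test y m x <= 1.
Proof.
have e1 : expR (- (`|y - x| + (y - x))) <= 1.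
  by rewrite -expR0 ler_expR oppr_le0 -lerBlDr sub0r -normrN ler_norm.
by rewrite /ray_test subr_ge0 exprn_ile1 ?expR_ge0 //= gerBl exprn_ge0 // expR_ge0.
Qed.

Lemma ray_test_cvg y x :
  (fun m => ray_test y m x) @ \oo --> (\1_(`]-oo, y[ : set R) x : R).
Proof.
rewrite indicE; have [xy|yx] := ltP x y.
  rewrite mem_set /=; last by rewrite in_itv.
  rewrite -[X in _ --> X]subr0; apply: cvgB; first exact: cvg_cst.
  apply: cvg_expr; rewrite ger0_norm ?expR_ge0 // -expR0 ltr_expR oppr_lt0.
  by have := normr_ge0 (y - x); lra.
rewrite memNset /=; last by rewrite in_itv /=; apply/negP; rewrite -leNgt.
rewrite /ray_test ler0_norm ?subr_le0 // addNr oppr0 expR0.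
by under eq_fun do rewrite expr1n subrr; exact: cvg_cst.
Qed.

Lemma occupation_ray y : \int[P]_w \1_(`]-oo, y[ : set R) (occ w) =
  \1_(`]-oo, y[ : set R) 0 * survival c lambda alpha t +
  \int[mu]_(s in `[0, t]) (\1_(`]-oo, y[ : set R) s * density c lambda alpha t s).
Proof.
have mr m : measurable_fun setT (ray_test y m).
  by apply: continuous_measurable_fun; exact: ray_test_continuous.
have PT : (P setT < +oo)%E by rewrite probability_setT ltry.
have h1 : (fun m => \int[P]_w ray_test y m (occ w)) @ \oo -->
    \int[P]_w \1_(`]-oo, y[ : set R) (occ w).
  apply: (@bounded_cvg_Rintegral _ _ _ P setT measurableT PT
    (fun m w => ray_test y m (occ w)) _ 1).
  - move=> m; exact: (measurableT_comp (mr m) measurable_occupation).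
  - by move=> w _; exact: ray_test_cvg.
  - by move=> m w _; have /andP[r0 r1] := ray_test01 y m (occ w); rewrite ger0_norm.
apply: (norm_cvg_unique h1).
rewrite (_ : (fun m => _) = (fun m => ray_test y m 0 * survival c lambda alpha t +
  \int[mu]_(s in `[0, t]) (ray_test y m s * density c lambda alpha t s))); last first.
  apply/funext => m.
  exact: (occupation_test (@ray_test_continuous y m) (ray_test01 y m)).
apply: cvgD.
  by apply: cvgM; [exact: ray_test_cvg|exact: cvg_cst].
apply: (@bounded_cvg_Rintegral _ _ _ mu `[0, t] (measurable_itv _)
  (lebesgue_segment_lty _ _)
  (fun m s => ray_test y m s * density c lambda alpha t s) _ lambda).
- move=> m; apply: measurable_funM; apply: measurable_funTS; first exact: mr.
  exact: (measurable_density c0 lambda0 alpha0 t0).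
- by move=> s _; apply: cvgM; [exact: ray_test_cvg|exact: cvg_cst].
- move=> m s _; have /andP[r0 r1] := ray_test01 y m s.
  have /andP[p0 p1] := density_bound c0 lambda0 alpha0 t0 s.
  rewrite ger0_norm; last exact: mulr_ge0.
  by rewrite -[leRHS]mul1r; apply: ler_pM.
Qed.

End occupation_law.

(** * Identification of the law *)

Section density_measure.
Context {R : realType}.
Local Notation mu := (@lebesgue_measure R).
Variables (h : R -> R).
Hypotheses (h0 : forall s, 0 <= h s) (mh : measurable_fun setT h).

Definition density_measure (B : set R) : \bar R := (\int[mu]_(s in B) (h s)%:E)%E.

Let density_measure0 : density_measure set0 = 0%E.
Proof. exact: integral_set0. Qed.

Let density_measure_ge0 B : (0 <= density_measure B)%E.
Proof. by apply: integral_ge0 => s _; rewrite lee_fin. Qed.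

Let density_measure_sigma_additive : semi_sigma_additive density_measure.
Proof.
move=> /= F mF tF mUF; rewrite /density_measure; apply: cvg_toP.
  apply: ereal_nondecreasing_is_cvgn => m n mn.
  by apply: lee_sum_nneg_natr => // k _ _; exact: density_measure_ge0.
rewrite ge0_integral_bigcup//=.
  by apply/measurable_funTS/measurable_EFinP.
by move=> x _; rewrite lee_fin.
Qed.

HB.instance Definition _ := isMeasure.Build _ _ _
  density_measure density_measure0 density_measure_ge0
  density_measure_sigma_additive.

(** Packaging the measure existentially keeps its hypotheses out of the way when
    it is added to a point mass. *)
Lemma density_measureP :
  exists m : {measure set R -> \bar R}, forall B, m B = density_measure B.
Proof. by exists density_measure. Qed.

End density_measure.

Section law_from_rays.
Context {R : realType} {d : measure_display} {Omega : measurableType d}.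
Local Notation mu := (@lebesgue_measure R).
Variables (P : probability Omega R) (X : Omega -> R) (a : R) (h : R -> R).
Hypotheses (mX : measurable_fun setT X) (a0 : 0 <= a).
Hypotheses (h0 : forall s, 0 <= h s) (mh : measurable_fun setT h).
Hypothesis rays : forall y, P (X @^-1` `]-oo, y[) =
  (a%:E * \d_(0 : R)%R (`]-oo, y[ : set R) + \int[mu]_(s in `]-oo, y[) (h s)%:E)%E.

Lemma law_from_rays (B : set R) : measurable B -> P (X @^-1` B) =
  (a%:E * \d_(0 : R)%R B + \int[mu]_(s in B) (h s)%:E)%E.
Proof.
have [m mE] := density_measureP h0 mh.
pose m1 := measure_function_pushforward__canonical__measure_function_Measure P mX.
pose m2 : {measure set R -> \bar R} := measure_add (mscale (NngNum a0) \d_(0 : R)) m.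
have m2E A : m2 A = (a%:E * \d_(0 : R)%R A + \int[mu]_(s in A) (h s)%:E)%E.
  by apply: (etrans (measure_addE _ _ A)); rewrite /mscale /= mE.
move=> mB; rewrite -m2E.
apply: (@measure_unique _ _ _ (@RGenInftyO.G R) (fun n => `]-oo, n%:R[%classic) _ _ _ _ m1 m2) => //.
- exact: RGenInftyO.measurableE.
- move=> _ _ [x ->] [y ->]; exists (Num.min x y).
  apply/seteqP; split => z /=; rewrite !in_itv /= lt_min.
    by move=> [-> ->].
  by move=> /andP.
- by move=> n; exists n%:R.
- apply/seteqP; split => // x _; exists (Num.truncn `|x|).+1 => //=.
  by rewrite in_itv /= (le_lt_trans (ler_norm x)) // truncnS_gt.
- by move=> A [y ->]; rewrite m2E -rays.
- move=> n; apply: (le_lt_trans (y := 1%E)); last exact: ltry.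
  apply: probability_le1; rewrite -[X in measurable X]setTI.
  exact: mX.
Qed.

End law_from_rays.

Unset Implicit Arguments.

Theorem proposition2p2 (R : realType) (d : measure_display)
    (Omega : measurableType d) (P : probability Omega R)
    (c lambda alpha : R) (c_gt0 : 0 < c) (lambda_gt0 : 0 < lambda)
    (alpha_gt0 : 0 < alpha)
    (N : R -> {RV P >-> nat}) (C : nat -> {RV P >-> R})
    (N_poisson : poisson_process lambda N)
    (C_iid : iid_exponential alpha C)
    (NC_indep : independent_systems P
       (sigma_process (`[0, +oo[ : set R) (fun t => N t : Omega -> nat))
       (sigma_process [set: nat] (fun i => C i : Omega -> R)))
    (t : R) (t_gt0 : 0 < t) :
  measurable_fun [set: Omega] (occupation_time (surplus c N C) t) /\
  forall B : set R, measurable B ->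
    (P [set w | B (occupation_time (surplus c N C) t w)] =
     (a_ c lambda alpha t)%:E * \d_(0 : R)%R B +
     \int[lebesgue_measure]_(s in B)
       (a_ c lambda alpha (t - s)
        * (lambda - c * alpha * (1 - a_ c lambda alpha s))
        * \1_(`]0, t[ : set R) s)%:E)%E.
Proof.
have mocc := measurable_occupation c_gt0 t_gt0 C N_poisson.
split=> // B mB.
pose occ := occupation_time (surplus c N C) t.
pose dens := density c lambda alpha t.
have densE s : a_ c lambda alpha (t - s)
    * (lambda - c * alpha * (1 - a_ c lambda alpha s))
    * \1_(`]0, t[ : set R) s = dens s.
  rewrite /dens /density patchE indicE; case: ifPn => [|_]; last by rewrite mulr0.
  rewrite inE /= in_itv /= => /andP[s0 st].
  rewrite mulr1 !a_E ?(ltW s0) ?subr_ge0 ?(ltW st) //.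
  by rewrite /raw_density /below_rate /survival; ring.
under eq_integral do rewrite densE.
have -> : a_ c lambda alpha t = survival c lambda alpha t.
  by rewrite a_E // ltW.
have dens_bound := density_bound c_gt0 lambda_gt0 alpha_gt0 t_gt0.
have dens0' s : 0 <= dens s by have /andP[] := dens_bound s.
have mdens := measurable_density c_gt0 lambda_gt0 alpha_gt0 t_gt0.
apply: (law_from_rays mocc (survival_ge0 c_gt0 lambda_gt0 alpha_gt0 t_gt0) dens0' mdens) => // y.
have mocc_ray : measurable (occ @^-1` `]-oo, y[).
  by rewrite -[X in measurable X]setTI; exact: mocc.
have L : \int[P]_w \1_(`]-oo, y[ : set R) (occ w) = fine (P (occ @^-1` `]-oo, y[)).
  rewrite /Rintegral -[in RHS](setIT (occ @^-1` _)) -integral_indic //.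
have Rt : (\int[lebesgue_measure]_(s in `[0%R, t]) (\1_(`]-oo, y[ : set R) s * dens s)%:E =
    \int[lebesgue_measure]_(s in `]-oo, y[) (dens s)%:E)%E.
  rewrite integral_mkcond [RHS]integral_mkcond; apply: eq_integral => s _.
  rewrite !patchE indicE; case: (s \in `]-oo, y[%classic); last first.
    by rewrite mul0r; case: ifP.
  rewrite mul1r; case: ifPn => // st.
  rewrite /dens /density patchE; case: ifPn => // st'.
  move/negP: st => []; rewrite inE; apply: subset_itv_oo_cc; by rewrite inE in st'.
have ir : lebesgue_measure.-integrable `[0, t] (EFin \o (fun s => \1_(`]-oo, y[ : set R) s * dens s)).
  apply: (@bounded_measurable_integrable _ _ _ lebesgue_measure _ (measurable_itv _)
    (lebesgue_segment_lty _ _) _ lambda).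
    by apply: measurable_funM => //; apply: measurable_funTS.
  move=> s _; have /andP[p0 p1] := dens_bound s; rewrite indicE.
  by case: (_ \in _); rewrite ?mul1r ?mul0r ?normr0 ?(ltW lambda_gt0) // ger0_norm.
have E := congr1 EFin
  (occupation_ray c_gt0 lambda_gt0 alpha_gt0 t_gt0 N_poisson C_iid NC_indep y).
rewrite L fineK in E; last exact: fin_num_measure.
apply: (etrans E); rewrite EFinD EFinM muleC /Rintegral fineK; last first.
  exact: integrable_fin_num.
by rewrite -/dens Rt diracE indicE.
Qed.
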